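(* Consider a stochastic click bandit on the item set $[K]$ (with $K$ positions) satisfying Assumptions A1–A5 below, with attraction probabilities $\alpha(1) > \alpha(2) > \dots > \alpha(K) > 0$. Let ${\sf BubbleRank}$ be run for $n$ steps with confidence parameter $\delta \in (0,1)$ and initial base list $\mathcal{R}_0$. Then its expected $n$-step regret satisfies $$R(n) \le 180\, K\, \frac{\chi_{\max}}{\chi_{\min}}\, \frac{K - 1 + 2|\mathcal{V}_0|}{\Delta_{\min}} \log(1/\delta) + \delta^{1/2} K^3 n^2 .$$
   Context: Model. Items are $\mathcal{D} = [K]$; a list $\mathcal{R}$ is an ordering of all $K$ items, $\mathcal{R}(k)$ is the item at position $k$ and $\mathcal{R}^{-1}(i)$ the position of item $i$; $\Pi_K$ denotes the set of such lists. A stochastic click bandit is given by a distribution $P_\alpha$ over attraction vectors in $\{0,1\}^K$ and a distribution $P_\chi$ over examination matrices in $\{0,1\}^{\Pi_K \times [K]}$. At each time $t$, $(\mathbf{A}_t, \mathbf{X}_t)$ is drawn i.i.d. from $P_\alpha \otimes P_\chi$; the learner chooses a list $\mathbf{R}_t$ (depending on the past) and observes clicks $\mathbf{c}_t(k) = \mathbf{X}_t(\mathbf{R}_t, k)\, \mathbf{A}_t(\mathbf{R}_t(k))$ for $k \in [K]$. Let $\alpha = \mathbb{E}[\mathbf{A}_t]$ (attraction probabilities) and $\chi = \mathbb{E}[\mathbf{X}_t]$ ($\chi(\mathcal{R},k)$ is the examination probability of position $k$ in $\mathcal{R}$), and $r(\mathcal{R},\alpha,\chi) = \sum_{k=1}^K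 \chi(\mathcal{R},k)\alpha(\mathcal{R}(k))$. The regret is $R(n) = \sum_{t=1}^n \mathbb{E}[\max_{\mathcal{R} \in \Pi_K} r(\mathcal{R},\alpha,\chi) - r(\mathbf{R}_t,\alpha,\chi)]$. Let $\mathcal{R}^* = (1,\dots,K)$, $\chi_{\max} = \chi(\mathcal{R}^*,1)$, $\chi_{\min} = \chi(\mathcal{R}^*,K)$, $\Delta_{\min} = \min_{k \in [K-1]} (\alpha(k) - \alpha(k+1))$. Assumptions: for all lists $\mathcal{R},\mathcal{R}'$ and positions $k<\ell$: (A1) $r(\mathcal{R},\alpha,\chi) \le r(\mathcal{R}^*,\alpha,\chi)$; (A2) if $\{\mathcal{R}(1),\dots,\mathcal{R}(k-1)\} = \{\mathcal{R}'(1),\dots,\mathcal{R}'(k-1)\}$ then $\chi(\mathcal{R},k) = \chi(\mathcal{R}',k)$; (A3) $\chi(\mathcal{R},k) \ge \chi(\mathcal{R},\ell)$; (A4) if $\mathcal{R}$ and $\mathcal{R}'$ differ only by exchanging the items at positions $k$ and $\ell$, then $\alpha(\mathcal{R}(k)) \le \alpha(\mathcal{R}(\ell)) \iff \chi(\mathcal{R},\ell) \ge \chi(\mathcal{R}',\ell)$; (A5) $\chi(\mathcal{R},k) \ge \chi(\mathcal{R}^*,k)$. Incorrectly-ordered pairs: $\mathcal{V}(\mathcal{R}) = \{(i,j) \in [K]^2 : i<j,\ \mathcal{R}^{-1}(i) > \mathcal{R}^{-1}(j)\}$ and $\mathcal{V}_0 = \mathcal{V}(\mathcal{R}_0)$.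 Algorithm ${\sf BubbleRank}$ (input: initial list $\mathcal{R}_0$, $\delta$, horizon $n$). Set $\mathbf{s}_0(i,j) = \mathbf{n}_0(i,j) = 0$ for all $i,j\in[K]$ and base list $\bar{\mathbf{R}}_1 = \mathcal{R}_0$. For $t = 1,\dots,n$: let $h = t \bmod 2$ and $\mathbf{R}_t \leftarrow \bar{\mathbf{R}}_t$. For each $k = 1,\dots,\lfloor (K-h)/2 \rfloor$, with $i = \mathbf{R}_t(2k-1+h)$, $j = \mathbf{R}_t(2k+h)$: if $\mathbf{s}_{t-1}(i,j) \le 2\sqrt{\mathbf{n}_{t-1}(i,j)\log(1/\delta)}$, exchange the items at positions $2k-1+h$ and $2k+h$ of $\mathbf{R}_t$ with probability $1/2$. Display $\mathbf{R}_t$ and observe $\mathbf{c}_t$. Set $\mathbf{s}_t = \mathbf{s}_{t-1}$, $\mathbf{n}_t = \mathbf{n}_{t-1}$; for each $k = 1,\dots,\lfloor (K-h)/2\rfloor$, with $i = \mathbf{R}_t(2k-1+h)$, $j = \mathbf{R}_t(2k+h)$: if $|\mathbf{c}_t(2k-1+h) - \mathbf{c}_t(2k+h)| = 1$, add $\mathbf{c}_t(2k-1+h) - \mathbf{c}_t(2k+h)$ to $\mathbf{s}_t(i,j)$, add $\mathbf{c}_t(2k+h) - \mathbf{c}_t(2k-1+h)$ to $\mathbf{s}_t(j,i)$, and add $1$ to both $\mathbf{n}_t(i,j)$ and $\mathbf{n}_t(j,i)$. Finally set $\bar{\mathbf{R}}_{t+1} = \bar{\mathbf{R}}_t$ and for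 $k = 1,\dots,K-1$ in order, with $i = \bar{\mathbf{R}}_{t+1}(k)$, $j = \bar{\mathbf{R}}_{t+1}(k+1)$: if $\mathbf{s}_t(j,i) > 2\sqrt{\mathbf{n}_t(j,i)\log(1/\delta)}$, exchange the items at positions $k$ and $k+1$ of $\bar{\mathbf{R}}_{t+1}$. *)

(* Defs.v *)
From HB Require Import structures.
From mathcomp Require Import all_boot all_order all_algebra fingroup perm.
From mathcomp Require Import reals exp.
Set Implicit Arguments. Unset Strict Implicit. Unset Printing Implicit Defensive.
Import Order.TTheory GRing.Theory Num.Theory.
Local Open Scope ring_scope.

(* Items and positions are both 'I_K (0-based: paper's position/item k is
   ordinal k-1).  A list is a permutation L : {perm 'I_K} with
   L k = item displayed at position k, and (L^-1)%g i = position of item i.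
   The optimal list R* = (1,...,K) is the identity permutation 1%g. *)

Section ClickBandit.
Variables (R : realType) (K : nat).

Definition attr_vec := {ffun 'I_K -> bool}.
Definition exam_mat := {ffun {perm 'I_K} * 'I_K -> bool}.
Definition coin_vec := {ffun 'I_K -> bool}.

Definition is_pmf (T : finType) (P : T -> R) :=
  (forall x, 0 <= P x) /\ \sum_(x : T) P x = 1.

Definition alpha (Pa : attr_vec -> R) (i : 'I_K) : R :=
  \sum_(A : attr_vec) Pa A * (A i)%:R.
Definition chi (Pc : exam_mat -> R) (L : {perm 'I_K}) (k : 'I_K) : R :=
  \sum_(X : exam_mat) Pc X * (X (L, k))%:R.

Definition rew (a : 'I_K -> R) (c : {perm 'I_K} -> 'I_K -> R)
  (L : {perm 'I_K}) : R := \sum_(k : 'I_K) c L k * a (L k).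

Definition swap_pos (L : {perm 'I_K}) (x y : 'I_K) : {perm 'I_K} :=
  (tperm x y * L)%g.

Definition opair (p : nat) : option ('I_K * 'I_K) :=
  match (insub p : option 'I_K), (insub p.+1 : option 'I_K) with
  | Some x, Some y => Some (x, y)
  | _, _ => None
  end.

Definition A1 (a : 'I_K -> R) (c : {perm 'I_K} -> 'I_K -> R) :=
  forall L, rew a c L <= rew a c 1%g.
Definition A2 (c : {perm 'I_K} -> 'I_K -> R) :=
  forall (L L' : {perm 'I_K}) (k : 'I_K),
    L @: [set j : 'I_K | (j < k)%N] = L' @: [set j : 'I_K | (j < k)%N] ->
    c L k = c L' k.
Definition A3 (c : {perm 'I_K} -> 'I_K -> R) :=
  forall (L : {perm 'I_K}) (k l : 'I_K), (k < l)%N -> c L l <= c L k.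
Definition A4 (a : 'I_K -> R) (c : {perm 'I_K} -> 'I_K -> R) :=
  forall (L L' : {perm 'I_K}) (k l : 'I_K), (k < l)%N ->
    L' = swap_pos L k l ->
    (a (L k) <= a (L l) <-> c L' l <= c L l).
Definition A5 (c : {perm 'I_K} -> 'I_K -> R) :=
  forall (L : {perm 'I_K}) (k : 'I_K), c 1%g k <= c L k.

Definition chi_max (c : {perm 'I_K} -> 'I_K -> R) : R :=
  if (insub 0%N : option 'I_K) is Some o then c 1%g o else 0.
Definition chi_min (c : {perm 'I_K} -> 'I_K -> R) : R :=
  if (insub K.-1 : option 'I_K) is Some o then c 1%g o else 0.

(* Delta_min = min_{k in [K-1]} (alpha(k) - alpha(k+1)); the neutral value 1
   only matters when K <= 1 (then the bound's numerator K-1+2|V0| is 0). *)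
Definition Delta_min (a : 'I_K -> R) : R :=
  \big[Num.min/1]_(p <- iota 0 K)
     (if opair p is Some (x, y) then a x - a y else 1).

Definition Vset (L : {perm 'I_K}) : {set 'I_K * 'I_K} :=
  [set ij : 'I_K * 'I_K | (ij.1 < ij.2)%N && ((L^-1)%g ij.2 < (L^-1)%g ij.1)%N].

Record bstate := BState {
  st_s : 'I_K -> 'I_K -> int;
  st_n : 'I_K -> 'I_K -> nat;
  st_base : {perm 'I_K} }.

Definition init_state (R0 : {perm 'I_K}) : bstate :=
  BState (fun _ _ => 0) (fun _ _ => 0%N) R0.

Definition ltest (delta : R) (s : int) (m : nat) : bool :=
  s%:~R <= 2 * Num.sqrt (m%:R * ln (delta^-1)).

(* first (0-based) positions of the pairs compared at time t: the paper's
   pairs (2k-1+h, 2k+h), h = t mod 2, become (p, p+1) with p = h mod 2 *)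
Definition pairs (t : nat) : seq nat :=
  [seq p <- iota 0 K | odd p == odd t].

Definition display (delta : R) (st : bstate) (t : nat) (coins : coin_vec)
  : {perm 'I_K} :=
  foldl (fun (L : {perm 'I_K}) (p : nat) =>
    if opair p is Some (x, y) then
      let i := L x in let j := L y in
      if ltest delta (st_s st i j) (st_n st i j) && coins x
      then swap_pos L x y else L
    else L) (st_base st) (pairs t).

Definition upd_stats (L : {perm 'I_K}) (c : 'I_K -> bool)
  (sn : ('I_K -> 'I_K -> int) * ('I_K -> 'I_K -> nat)) (p : nat) :=
  if opair p is Some (x, y) then
    let i := L x in let j := L y in
    if c x != c y then
      let d : int := (c x)%:R - (c y)%:R in
      ((fun u v => sn.1 u v +
          (if (u == i) && (v == j) then d
           else if (u == j) && (v == i) then - d else 0)),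
       (fun u v => (sn.2 u v + ((u == i) && (v == j) || (u == j) && (v == i)))%N))
    else sn
  else sn.

Definition upd_base (delta : R) (s : 'I_K -> 'I_K -> int)
  (m : 'I_K -> 'I_K -> nat) (B : {perm 'I_K}) : {perm 'I_K} :=
  foldl (fun (B : {perm 'I_K}) (p : nat) =>
    if opair p is Some (x, y) then
      let i := B x in let j := B y in
      if ~~ ltest delta (s j i) (m j i) then swap_pos B x y else B
    else B) B (iota 0 K).

Definition step (delta : R) (st : bstate) (t : nat) (coins : coin_vec)
  (A : attr_vec) (X : exam_mat) : bstate :=
  let L := display delta st t coins in
  let c := fun k => X (L, k) && A (L k) in
  let sn := foldl (upd_stats L c) (st_s st, st_n st) (pairs t) in
  BState sn.1 sn.2 (upd_base delta sn.1 sn.2 (st_base st)).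

(* max_L r(L, alpha, chi) (all r values are >= 0, so 0 is a neutral start) *)
Definition opt_rew (a : 'I_K -> R) (c : {perm 'I_K} -> 'I_K -> R) : R :=
  \big[Num.max/0]_(L : {perm 'I_K}) rew a c L.

(* expected regret of steps t, ..., t+m-1 from state st; the randomness at each
   step is: uniform coins, A ~ Pa, X ~ Pc, all independent and fresh. *)
Fixpoint regret_from (Pa : attr_vec -> R) (Pc : exam_mat -> R) (delta : R)
  (m t : nat) (st : bstate) : R :=
  match m with
  | 0%N => 0
  | m'.+1 =>
    \sum_(coins : coin_vec) (2 ^+ K)^-1 *
    \sum_(A : attr_vec) Pa A * \sum_(X : exam_mat) Pc X *
      ((opt_rew (alpha Pa) (chi Pc)
          - rew (alpha Pa) (chi Pc) (display delta st t coins))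
       + regret_from Pa Pc delta m' t.+1 (step delta st t coins A X))
  end.

Definition bubblerank_regret (Pa : attr_vec -> R) (Pc : exam_mat -> R)
  (delta : R) (R0 : {perm 'I_K}) (n : nat) : R :=
  regret_from Pa Pc delta n 1 (init_state R0).

End ClickBandit.

(* Main.v *)
Require Import Defs.
From HB Require Import structures.
From mathcomp Require Import all_boot all_order all_algebra fingroup perm.
From mathcomp Require Import reals sequences exp.
From mathcomp Require Import zify ring lra.
Set Implicit Arguments. Unset Strict Implicit. Unset Printing Implicit Defensive.
Import Order.TTheory GRing.Theory Num.Theory.
Local Open Scope ring_scope.

(** A potential argument, by induction on the remaining number of rounds.

    Call a state good if every score [s(i, j)] with [i] better than [j] is at
    least [D / 2 * n - 2 * sqrt (n L)], where [n] is the number of recorded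
    comparisons, [D] the minimal gap and [L = ln (1 / delta)].  In a good state no
    pair is resolved the wrong way, so by A2-A4 item [i] is clicked without [j] more
    often than [j] without [i], by a factor at least [1 / (1 - D)].  Hence
    [exp (- th * s + (D / 2 * th - 2 * th ^ 2) * n)] is a supermartingale, and a sum
    of such terms over the pairs and over [th] dominates the event that the state
    is not good: this accounts for the [sqrt delta] term.

    In a good state the regret of a round is at most [K * chi_max] times the total
    gap of the unresolved neighbours of the base list, those compared in this round
    weighing three times.  Comparing a pair of gap [g] raises its score by at least
    [chi_min * g] in expectation, and an unresolved score is at most [16 L / D].
    Since every swap of the base list removes an inversion and creates at most two
    new neighbouring pairs, at most [K - 1 + 2 |V_0|] pairs are ever compared, so
    the total increase of the scores is bounded.  The unresolved neighbours not
    compared in this round are compared in the next one, unless the base list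
    changes, which costs an inversion. *)

(** * Finite expectations and one-sided clicks *)

Section Expectation.
Variables (R : realType) (T : finType) (P : T -> R).
Hypothesis Ppmf : is_pmf P.

Definition Ex (F : T -> R) : R := \sum_(w : T) P w * F w.

Lemma ExD F G : Ex (fun w => F w + G w) = Ex F + Ex G.
Proof. by rewrite /Ex -big_split; apply: eq_bigr => w _; rewrite mulrDr. Qed.

Lemma ExZ a F : Ex (fun w => a * F w) = a * Ex F.
Proof. by rewrite /Ex mulr_sumr; apply: eq_bigr => w _; rewrite mulrCA. Qed.

Lemma ExN F : Ex (fun w => - F w) = - Ex F.
Proof. by rewrite /Ex -sumrN; apply: eq_bigr => w _; rewrite mulrN. Qed.

Lemma Ex_cst a : Ex (fun=> a) = a.
Proof. by rewrite /Ex -mulr_suml Ppmf.2 mul1r. Qed.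

Lemma eq_Ex F G : F =1 G -> Ex F = Ex G.
Proof. by move=> e; apply: eq_bigr => w _; rewrite e. Qed.

Lemma Ex_le F G : (forall w, F w <= G w) -> Ex F <= Ex G.
Proof. by move=> h; apply: ler_sum => w _; apply: ler_wpM2l; rewrite ?Ppmf.1. Qed.

Lemma Ex_sum (I : Type) (s : seq I) (Q : pred I) (F : I -> T -> R) :
  Ex (fun w => \sum_(i <- s | Q i) F i w) = \sum_(i <- s | Q i) Ex (F i).
Proof.
rewrite /Ex exchange_big; apply: eq_bigr => w _.
by rewrite mulr_sumr.
Qed.

Definition only (a b : T -> bool) : R := Ex (fun w => (a w && ~~ b w)%:R).

Lemma only_ge0 a b : 0 <= only a b.
Proof. by rewrite -[0]Ex_cst; apply: Ex_le => w; rewrite ler0n. Qed.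

Lemma onlyB (a b : T -> bool) :
  only a b - only b a = Ex (fun w => (a w)%:R) - Ex (fun w => (b w)%:R).
Proof.
rewrite /only -!ExN -!ExD; apply: eq_Ex => w.
by case: (a w); case: (b w) => /=; lra.
Qed.

(** The joint event is removed from both sides; on the right it carries the weight [1 - D <= 1], so
    its removal preserves the inequality. *)
Lemma only_le (D : R) (a b : T -> bool) : 0 <= D -> D <= 1 ->
  Ex (fun w => (b w)%:R) <= (1 - D) * Ex (fun w => (a w)%:R) ->
  only b a <= (1 - D) * only a b.
Proof.
move=> D0 D1 h.
have e0 : 0 <= Ex (fun w => (a w && b w)%:R).
  by rewrite -[0]Ex_cst; apply: Ex_le => w; rewrite ler0n.
have ea : Ex (fun w => (a w)%:R) = only a b + Ex (fun w => (a w && b w)%:R).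
  by rewrite /only -ExD; apply: eq_Ex => w; case: (a w); case: (b w) => /=; lra.
have eb : Ex (fun w => (b w)%:R) = only b a + Ex (fun w => (a w && b w)%:R).
  by rewrite /only -ExD; apply: eq_Ex => w; case: (a w); case: (b w) => /=; lra.
rewrite ea eb in h.
by nra.
Qed.

(** Equal clicks leave the statistics of a pair unchanged, so the drift of any function of them
    depends only on the two one-sided click probabilities. *)
Lemma Ex_clicks (h : bool -> bool -> R) a b : h true true = h false false ->
  Ex (fun w => h (a w) (b w)) = h false false
    + (only a b * (h true false - h false false)
       + only b a * (h false true - h false false)).
Proof.
move=> e; rewrite -{1}[h false false]Ex_cst [only a b * _]mulrC [only b a * _]mulrC.
rewrite /only -!ExZ -!ExD; apply: eq_Ex => w.
by case: (a w); case: (b w) => /=; rewrite ?e; lra.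
Qed.

End Expectation.

(** * The truncated score and its drift *)

Section CappedScore.
Variable R : realType.

(* Truncation of the score at [c] with a geometric tail: it is bounded, and a walk
   whose down-steps are [w] times less likely than its up-steps keeps a
   non-negative drift above the cap. *)
Definition capf (c : nat) (w : R) (s : int) : R :=
  if s - c%:Z is Posz k then c%:R + \sum_(l < k) w ^+ l else s%:~R.

Definition capf_incr (c : nat) (w : R) (s : int) : R :=
  if s - c%:Z is Posz k then w ^+ k else 1.

Lemma capfS c w s : capf c w (s + 1) = capf c w s + capf_incr c w s.
Proof.
rewrite /capf /capf_incr.
have -> : s + 1 - c%:Z = (s - c%:Z) + 1 by lia.
case E: (s - c%:Z) => [k|k].
  have -> : Posz k + 1 = Posz k.+1 by lia.
  by rewrite big_ord_recr /= addrA.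
case: k E => [|k] E.
  have -> : Negz 0 + 1 = Posz 0 by [].
  have -> : s = c%:Z - 1 by lia.
  by rewrite big_ord0 rmorphB /= addr0 subrK.
have -> : Negz k.+1 + 1 = Negz k by lia.
by rewrite rmorphD.
Qed.

Lemma capfP c w s : capf c w (s - 1) = capf c w s - capf_incr c w (s - 1).
Proof. by rewrite -{2}[s](subrK 1) capfS addrK. Qed.

Lemma capf0 c w : capf c w 0 = 0.
Proof.
rewrite /capf; case: c => [|c]; first by rewrite (_ : 0 - 0%:Z = Posz 0) // big_ord0 add0r.
by rewrite (_ : 0 - c.+1%:Z = Negz c) //; lia.
Qed.

(** The geometric tail with ratio [1 - D] sums to at most [D^-1]. *)
Lemma capf_le c (D : R) s : 0 < D -> D <= 1 -> capf c (1 - D) s <= c%:R + D^-1.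
Proof.
move=> D0 D1; rewrite /capf; case E: (s - c%:Z) => [k|k].
  rewrite lerD2l -(ler_pM2l D0) mulfV ?gt_eqF //.
  have -> : D * \sum_(l < k) (1 - D) ^+ l = 1 - (1 - D) ^+ k.
    elim: k {E} => [|k IH]; first by rewrite big_ord0 expr0 mulr0 subrr.
    by rewrite big_ord_recr /= mulrDr IH exprS; ring.
  by rewrite gerBl exprn_ge0 // subr_ge0.
have sc : s <= c%:Z by lia.
have : s%:~R <= c%:R :> R by rewrite -(ler_int R) in sc.
by move=> /le_trans; apply; rewrite lerDl invr_ge0 ltW.
Qed.

(** Strictly above the cap the increment upwards is [1 - D] times the increment downwards, which the
    ratio of [r] to [p] compensates; elsewhere both increments are 1 and the drift is [p - r]. *)
Lemma capf_incr_drift c (D : R) s p r : 0 <= D -> D <= 1 -> 0 <= p -> r <= (1 - D) * p ->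
  0 <= p * capf_incr c (1 - D) s - r * capf_incr c (1 - D) (s - 1).
Proof.
move=> D0 D1 p0 rp; rewrite /capf_incr.
have -> : s - 1 - c%:Z = (s - c%:Z) - 1 by lia.
case: (s - c%:Z) => [[|k]|k].
- have -> : Posz 0 - 1 = Negz 0 by [].
  by rewrite expr0; nra.
- have -> : Posz k.+1 - 1 = Posz k by lia.
  have w0 : 0 <= (1 - D) ^+ k by rewrite exprn_ge0 // subr_ge0.
  by rewrite exprS; nra.
- have -> : Negz k - 1 = Negz k.+1 by lia.
  by nra.
Qed.

Lemma capf_drift_ge0 c (D : R) s p r : 0 <= D -> D <= 1 -> 0 <= p -> r <= (1 - D) * p ->
  0 <= p * (capf c (1 - D) (s + 1) - capf c (1 - D) s)
       + r * (capf c (1 - D) (s - 1) - capf c (1 - D) s).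
Proof.
move=> D0 D1 p0 rp; rewrite capfS capfP.
have := capf_incr_drift c s D0 D1 p0 rp.
by congr (0 <= _); ring.
Qed.

Lemma capf_drift_lin c (w : R) s (p r : R) : s <= c%:Z ->
  p * (capf c w (s + 1) - capf c w s) + r * (capf c w (s - 1) - capf c w s) = p - r.
Proof.
move=> sc; rewrite capfS capfP.
have -> : capf_incr c w s = 1.
  by rewrite /capf_incr; case E: (s - c%:Z) => [[|k]|k] //; lia.
have -> : capf_incr c w (s - 1) = 1.
  by rewrite /capf_incr; case E: (s - 1 - c%:Z) => [[|k]|k] //; lia.
by ring.
Qed.

End CappedScore.

(** * One-step inequalities for exponential supermartingales *)

Section ExponentialBounds.
Variable R : realType.

(** Multiplied by [1 - x > 0], the left side is at most 1 because [1 - x <= expR (- x)], and the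
    right side becomes [1 + x ^+ 2 * (1 - 2 * x)]. *)
Lemma expR_le_quad (x : R) : x <= 2^-1 -> expR x <= 1 + x + 2 * x ^+ 2.
Proof.
move=> x2; have x1 : 0 < 1 - x by lra.
have h : expR (- x) >= 1 - x by exact: expR_ge1Dx.
have e : expR x * expR (- x) = 1 by rewrite expRxMexpNx_1.
have := expR_gt0 x => e0.
have h2 : expR x * (1 - x) <= 1 by rewrite -[leRHS]e ler_wpM2l // ltW.
rewrite -(ler_pM2r x1).
apply: le_trans h2 _.
have : 0 <= x ^+ 2 * (1 - 2 * x) by apply: mulr_ge0; [exact: sqr_ge0|lra].
by rewrite expr2; nra.
Qed.

(** The hypothesis on [r] gives [p - r >= D / 2 * (p + r)]. To second order the mean factor is
    therefore at most [(p + r) * (1 - ka)], and the compensator [ka] absorbs it since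
    [1 - ka <= expR (- ka)]. *)
Lemma exp_drift (D th p r : R) : 0 <= D -> 0 <= th -> th <= 2^-1 ->
  0 <= p -> 0 <= r -> r <= (1 - D) * p ->
  p * (expR (- th + (D / 2 * th - 2 * th ^+ 2)) - 1)
  + r * (expR (th + (D / 2 * th - 2 * th ^+ 2)) - 1) <= 0.
Proof.
move=> D0 t0 t2 p0 r0 rp; set ka := D / 2 * th - _.
rewrite [expR (- th + ka)]expRD [expR (th + ka)]expRD.
have h1 : expR (- th) <= 1 - th + 2 * th ^+ 2.
  by have := @expR_le_quad (- th); rewrite sqrrN; apply; lra.
have h2 := expR_le_quad t2.
have hk : 1 - ka <= expR (- ka) by exact: expR_ge1Dx.
have e : expR ka * expR (- ka) = 1 by rewrite expRxMexpNx_1.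
have k0 := expR_gt0 ka.
have main : p * expR (- th) + r * expR th <= (p + r) * expR (- ka).
  have a1 : p * expR (- th) <= p * (1 - th + 2 * th ^+ 2) by rewrite ler_wpM2l.
  have a2 : r * expR th <= r * (1 + th + 2 * th ^+ 2) by rewrite ler_wpM2l.
  have a3 : (p + r) * (1 - (D / 2 * th - 2 * th ^+ 2)) <= (p + r) * expR (- ka).
    by rewrite ler_wpM2l // addr_ge0.
  have a4 : 0 <= th * (p - r - D / 2 * (p + r)).
    apply: mulr_ge0 => //.
    have : D * r <= D * p by apply: ler_wpM2l => //; nra.
    by nra.
  by move: a1 a2 a3 a4; rewrite expr2; lra.
have : expR ka * (p * expR (- th) + r * expR th) <= expR ka * ((p + r) * expR (- ka)).
  by rewrite ler_wpM2l // ltW.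
by rewrite [X in _ <= X]mulrCA e => h; lra.
Qed.

End ExponentialBounds.

(** * Positions, compared pairs and the update of the statistics *)

Section Lists.
Variable K : nat.
Implicit Types (L B : {perm 'I_K}) (t : nat).

Definition pos L (i : 'I_K) : 'I_K := (L^-1)%g i.

Lemma posK L i : L (pos L i) = i.
Proof. exact: permKV. Qed.

Lemma pos_perm L x : pos L (L x) = x.
Proof. exact: permK. Qed.

Lemma pos_inj L : injective (pos L).
Proof. exact: perm_inj. Qed.

Lemma eq_pos L x u : (u == L x) = (pos L u == x).
Proof. by rewrite -{1}(posK L u) (inj_eq perm_inj). Qed.

Variant opair_spec p : option ('I_K * 'I_K) -> Type :=
  | OpairSome (x y : 'I_K) of x = p :> nat & y = p.+1 :> nat :
      opair_spec p (Some (x, y))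
  | OpairNone of (K <= p.+1)%N : opair_spec p None.

Lemma opairP p : opair_spec p (opair K p).
Proof.
rewrite /opair; case: insubP => [x _ ex|].
  by case: insubP => [y _ ey|]; [constructor|rewrite -leqNgt; constructor].
by rewrite -leqNgt => h; constructor; apply: leq_trans h _.
Qed.

(** The positions whose items are compared with each other in round [t], in either order. *)
Definition linked t (a b : nat) :=
  (b == a.+1) && (odd a == odd t) || (a == b.+1) && (odd b == odd t).

Lemma linkedC t a b : linked t a b = linked t b a.
Proof. by rewrite /linked orbC. Qed.

Lemma linked_adj t a b : linked t a b -> (b == a.+1) || (a == b.+1).
Proof. by case/orP => /andP[-> _]; rewrite ?orbT. Qed.

(** Pairs whose first positions have the same parity are disjoint. Hence the exchanges do not
    interfere, and every decision can be read off the initial list. *)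
Lemma foldl_swap_pairs (sw : {perm 'I_K} -> 'I_K -> 'I_K -> bool) (q : bool) :
  (forall L L' x y, L x = L' x -> L y = L' y -> sw L x y = sw L' x y) ->
  forall (ps : seq nat) L0, uniq ps -> all (fun p => odd p == q) ps ->
  let L := foldl (fun (L : {perm 'I_K}) (p : nat) =>
    if opair K p is Some (x, y) then
      if sw L x y then swap_pos L x y else L else L) L0 ps in
  (forall x y : 'I_K, y = x.+1 :> nat -> (x : nat) \in ps ->
     L x = (if sw L0 x y then L0 y else L0 x) /\
     L y = (if sw L0 x y then L0 x else L0 y)) /\
  (forall z : 'I_K, ((z : nat) \in ps -> z.+1 = K) ->
     ((0 < z)%N -> z.-1 \notin ps) -> L z = L0 z).
Proof.
move=> swE; elim=> [|p ps IH] L0 /=; first by [].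
case/andP=> pps ups /andP[/eqP op aps].
case: opairP => [x y ex ey|Kp].
  set L1 := if _ then _ else _.
  have ps_odd r : r \in ps -> odd r = q by move/(allP aps)/eqP.
  have L1x : L1 x = if sw L0 x y then L0 y else L0 x.
    by rewrite /L1; case: ifP => // _; rewrite /swap_pos permM tpermL.
  have L1y : L1 y = if sw L0 x y then L0 x else L0 y.
    by rewrite /L1; case: ifP => // _; rewrite /swap_pos permM tpermR.
  have L1z z : z != x -> z != y -> L1 z = L0 z.
    move=> zx zy; rewrite /L1; case: ifP => // _.
    by rewrite /swap_pos permM tpermD // eq_sym.
  have [h1 h2] := IH L1 ups aps.
  have yps : (y : nat) \notin ps.
    by apply/negP => /ps_odd; rewrite ey /= op; case: (q).
  have xP : (0 < x)%N -> x.-1 \notin ps.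
    move=> x0; apply/negP => /ps_odd.
    by rewrite -op -ex; case: (x : nat) x0 => //= m _; case: (odd m).
  split.
    move=> x' y' ey'; rewrite inE => /orP[/eqP e|x'ps].
      have -> : x' = x by apply: val_inj; rewrite /= e ex.
      have -> : y' = y by apply: val_inj; rewrite /= ey' e ey.
      rewrite (h2 x) //; last by rewrite ex => /(negP pps).
      by rewrite (h2 y) //; [move/(negP yps)|rewrite ey].
    have x'x : x' != x by apply: contraNneq pps => e; rewrite -ex -e.
    have ox' : odd x' = q by apply: ps_odd.
    have ox : odd x = q by rewrite ex.
    have x'y : x' != y.
      by apply/eqP => e; move: ox'; rewrite e ey /= op; case: (q).
    have y'x : y' != x.
      by apply/eqP => e; move: ox; rewrite -e ey' /= ox'; case: (q).
    have y'y : y' != y.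
      apply: contra x'x => /eqP e; apply/eqP/val_inj => /=.
      by move: (congr1 val e) => /=; rewrite ey' ey -ex => -[].
    have [-> ->] := h1 _ _ ey' x'ps.
    have e1 := L1z _ x'x x'y; have e2 := L1z _ y'x y'y.
    by rewrite e1 e2 (swE L1 L0).
  move=> z zps zP.
  have zx : z != x.
    apply/eqP => e; move: zps; rewrite e ex inE eqxx => /(_ isT) e2.
    by move: (ltn_ord y); rewrite ey e2 ltnn.
  have zy : z != y.
    by apply/eqP => e; move: zP; rewrite e ey /= inE eqxx => /(_ isT).
  rewrite h2 ?L1z //.
    by move=> h; apply: zps; rewrite inE h orbT.
  by move/zP; rewrite inE negb_or => /andP[].
have [h1 h2] := IH L0 ups aps; split.
  move=> x y ey; rewrite inE => /orP[/eqP e|]; last exact: h1.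
  by move: (ltn_ord y); rewrite ey e ltnNge Kp.
move=> z zps zP; apply: h2.
  by move=> h; apply: zps; rewrite inE h orbT.
by move/zP; rewrite inE negb_or => /andP[].
Qed.

Definition link (p a b : nat) := (a == p) && (b == p.+1) || (b == p) && (a == p.+1).

(** Every compared pair is visited exactly once in a round, so the fold over [pairs K t] records at
    most one comparison for it. *)
Lemma count_link t (a b : 'I_K) : count (fun p => link p a b) (pairs K t) = linked t a b.
Proof.
have uP : uniq (pairs K t) by rewrite filter_uniq // iota_uniq.
have inP (z : 'I_K) : ((z : nat) \in pairs K t) = (odd z == odd t).
  by rewrite mem_filter mem_iota /= add0n ltn_ord andbT.
rewrite /linked; case: (eqVneq (b : nat) a.+1) => [e|ne] /=.
  rewrite (@eq_count _ _ (pred1 (a : nat))) ?count_uniq_mem ?inP //.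
    by rewrite e ltn_eqF ?orbF // ltnS leqnSn.
  by move=> p; rewrite /link /= e; apply/idP/idP; lia.
case: (eqVneq (a : nat) b.+1) => [e|ne'] /=.
  rewrite (@eq_count _ _ (pred1 (b : nat))) ?count_uniq_mem ?inP //.
  by move=> p; rewrite /link /= e; apply/idP/idP; lia.
rewrite (@eq_count _ _ pred0) ?count_pred0 // => p /=.
by apply/negbTE; rewrite /link; lia.
Qed.

Lemma upd_stats_s L c sn p u v :
  (upd_stats L c sn p).1 u v = sn.1 u v
   + (((c (pos L u))%:R : int) - (c (pos L v))%:R) *+ link p (pos L u) (pos L v).
Proof.
rewrite /upd_stats; case: opairP => [x y ex ey|Kp]; last first.
  suff -> : link p (pos L u) (pos L v) = false by rewrite mulr0n addr0.
  apply/negbTE; rewrite /link.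
  by move: (ltn_ord (pos L u)) (ltn_ord (pos L v)); lia.
have -> : link p (pos L u) (pos L v) =
  (u == L x) && (v == L y) || (u == L y) && (v == L x).
  by rewrite !eq_pos -!val_eqE /= ex ey /link [in X in _ || X]andbC.
case: ifP => /= cxy; rewrite !eq_pos.
  case: ifP => [/andP[/eqP -> /eqP ->]|h1] /=; first by [].
  case: ifP => [/andP[/eqP -> /eqP ->]|h2] /=; last by rewrite mulr0n.
  by rewrite opprB.
move/negbFE/eqP: cxy => cxy.
case: (boolP (_ || _)) => [/orP[]/andP[/eqP -> /eqP ->]|_]; rewrite ?mulr0n ?addr0 //.
  by rewrite cxy subrr mul0rn addr0.
by rewrite cxy subrr mul0rn addr0.
Qed.

Lemma upd_stats_n L c sn p u v :
  (upd_stats L c sn p).2 u v = (sn.2 u v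
   + (c (pos L u) != c (pos L v)) * link p (pos L u) (pos L v))%N.
Proof.
rewrite /upd_stats; case: opairP => [x y ex ey|Kp]; last first.
  suff -> : link p (pos L u) (pos L v) = false by rewrite muln0 addn0.
  apply/negbTE; rewrite /link.
  by move: (ltn_ord (pos L u)) (ltn_ord (pos L v)); lia.
have -> : link p (pos L u) (pos L v) =
  (u == L x) && (v == L y) || (u == L y) && (v == L x).
  by rewrite !eq_pos -!val_eqE /= ex ey /link [in X in _ || X]andbC.
case: ifP => /= cxy; rewrite !eq_pos.
  case: (boolP (_ || _)) => [/orP[]/andP[/eqP -> /eqP ->]|_]; rewrite ?muln0 //.
    by rewrite cxy.
  by rewrite [c y == _]eq_sym cxy.
move/negbFE/eqP: cxy => cxy.
case: (boolP (_ || _)) => [/orP[]/andP[/eqP -> /eqP ->]|_]; rewrite ?muln0 ?addn0 //.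
  by rewrite cxy eqxx mul0n addn0.
by rewrite cxy eqxx mul0n addn0.
Qed.

Lemma foldl_upd_stats L c sn ps u v :
  (foldl (upd_stats L c) sn ps).1 u v = sn.1 u v
   + (((c (pos L u))%:R : int) - (c (pos L v))%:R)
      *+ count (fun p => link p (pos L u) (pos L v)) ps /\
  (foldl (upd_stats L c) sn ps).2 u v = (sn.2 u v
   + (c (pos L u) != c (pos L v)) * count (fun p => link p (pos L u) (pos L v)) ps)%N.
Proof.
elim: ps sn => [|p ps IH] sn /=; first by rewrite mulr0n muln0 addr0 addn0.
have [-> ->] := IH (upd_stats L c sn p).
by rewrite upd_stats_s upd_stats_n mulrnDr mulnDr addrA addnA.
Qed.

End Lists.

(** * One round of the algorithm: displayed list and statistics *)

Section Algorithm.
Variables (R : realType) (K : nat) (delta : R).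
Implicit Types (st : bstate K) (L B : {perm 'I_K}) (t : nat) (coins : coin_vec K).

Definition unres st u v := ltest delta (st_s st u v) (st_n st u v).

Lemma display_pair st t coins (x y : 'I_K) :
  y = x.+1 :> nat -> odd x == odd t ->
  let B := st_base st in let b := unres st (B x) (B y) && coins x in
  display delta st t coins x = (if b then B y else B x) /\
  display delta st t coins y = (if b then B x else B y).
Proof.
move=> ey ox /=.
pose sw L (x y : 'I_K) := unres st (L x) (L y) && coins x.
have := @foldl_swap_pairs K sw (odd t) _ (pairs K t) (st_base st).
case.
- by move=> L L' a b ea eb; rewrite /sw ea eb.
- by rewrite filter_uniq // iota_uniq.
- by apply/allP => p; rewrite mem_filter => /andP[].
move=> h _; apply: h => //.
by rewrite mem_filter ox mem_iota /= add0n.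
Qed.

Lemma display_single st t coins (z : 'I_K) :
  (odd z == odd t -> z.+1 = K) -> ((0 < z)%N -> odd z.-1 != odd t) ->
  display delta st t coins z = st_base st z.
Proof.
move=> h1 h2.
pose sw L (x y : 'I_K) := unres st (L x) (L y) && coins x.
have := @foldl_swap_pairs K sw (odd t) _ (pairs K t) (st_base st).
case.
- by move=> L L' a b ea eb; rewrite /sw ea eb.
- by rewrite filter_uniq // iota_uniq.
- by apply/allP => p; rewrite mem_filter => /andP[].
move=> _ h; apply: h.
  by rewrite mem_filter => /andP[/h1].
by move=> z0; rewrite mem_filter negb_and h2.
Qed.

Variant place_spec t (z : 'I_K) : Type :=
  | PlaceFirst (y : 'I_K) of y = z.+1 :> nat & odd z == odd t
  | PlaceSecond (x : 'I_K) of z = x.+1 :> nat & odd x == odd t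
  | PlaceSingle of (odd z == odd t -> z.+1 = K) & ((0 < z)%N -> odd z.-1 != odd t).

Lemma placeP t z : place_spec t z.
Proof.
case: (boolP (odd z == odd t)) => oz.
  case: (ltnP z.+1 K) => zK; first exact: (@PlaceFirst t z (Ordinal zK)).
  apply: PlaceSingle => [_|z0]; first by apply/eqP; rewrite eqn_leq ltn_ord zK.
  by case: (z : nat) z0 oz => //= m _ /eqP <-; case: (odd m).
case: (posnP z) => z0.
  by apply: PlaceSingle; [move=> h; rewrite h in oz|rewrite z0].
have zK : (z.-1 < K)%N by apply: leq_ltn_trans (ltn_ord z); exact: leq_pred.
apply: (@PlaceSecond t z (Ordinal zK)) => /=; first by rewrite prednK.
by case: (z : nat) z0 oz => //= m _; case: (odd m); case: (odd t).
Qed.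

Lemma display_linked st t coins (x y : 'I_K) : linked t x y ->
  let L := display delta st t coins in let B := st_base st in
  (L x = B x /\ L y = B y) \/ (L x = B y /\ L y = B x).
Proof.
case/orP => /andP[/eqP e o] /=.
  by have [-> ->] := display_pair st coins e o; case: ifP => _; [right|left].
by have [-> ->] := display_pair st coins e o; case: ifP => _; [right|left].
Qed.

(** Exchanges in the display stay inside compared pairs. Which items are compared is thus decided by
    the base list and not by the coins. *)
Lemma linked_display st t coins u v :
  linked t (pos (display delta st t coins) u) (pos (display delta st t coins) v)
  = linked t (pos (st_base st) u) (pos (st_base st) v).
Proof.
set L := display _ _ _ _; set B := st_base st.
have P (M : {perm 'I_K}) w z : w = M z -> pos M w = z by move=> ->; rewrite pos_perm.
apply/idP/idP => h; have /= := display_linked st coins h; rewrite -/L -/B !posK.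
  case=> -[/(P B _ _) -> /(P B _ _) ->] //.
  by rewrite linkedC.
case=> -[/esym/(P L _ _) -> /esym/(P L _ _) ->] //.
by rewrite linkedC.
Qed.

Definition flip coins (x : 'I_K) : coin_vec K :=
  [ffun z => if z == x then ~~ coins z else coins z].

Lemma flipK x : involutive (flip^~ x).
Proof.
move=> c; apply/ffunP => z; rewrite !ffunE.
by case: eqVneq => // _; rewrite negbK.
Qed.

(** The coin at [x] governs only the pair at [x] and [y]. Flipping it is a measure-preserving
    involution, which later serves to average out the position bias. *)
Lemma display_flip st t coins (x y : 'I_K) :
  y = x.+1 :> nat -> odd x == odd t -> unres st (st_base st x) (st_base st y) ->
  display delta st t (flip coins x) = swap_pos (display delta st t coins) x y.
Proof.
move=> ey ox un; apply/permP => z.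
have [Lx Ly] := display_pair st coins ey ox.
have [Lx' Ly'] := display_pair st (flip coins x) ey ox.
rewrite un /= in Lx Ly Lx' Ly'; rewrite ffunE eqxx in Lx' Ly'.
rewrite /swap_pos permM; case: tpermP => [->|->|zx zy].
- by rewrite Lx' Ly; case: (coins x).
- by rewrite Ly' Lx; case: (coins x).
have fz w : w <> x -> flip coins x w = coins w.
  by move=> /eqP/negbTE h; rewrite ffunE h.
case: (placeP t z) => [y' e o|x' e o|h1 h2].
- have [-> _] := display_pair st (flip coins x) e o.
  by have [-> _] := display_pair st coins e o; rewrite fz.
- have [_ ->] := display_pair st (flip coins x) e o.
  have [_ ->] := display_pair st coins e o; rewrite fz // => xx.
  by apply: zy; apply: val_inj; rewrite /= e ey xx.
- by rewrite !display_single.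
Qed.

Definition click st t coins (A : attr_vec K) (X : exam_mat K) u :=
  X (display delta st t coins, pos (display delta st t coins) u) && A u.

Lemma step_stats st t coins A X u v :
  let st' := step delta st t coins A X in
  let lk := linked t (pos (st_base st) u) (pos (st_base st) v) in
  let ku := click st t coins A X u in let kv := click st t coins A X v in
  st_s st' u v = st_s st u v + ((ku%:R : int) - kv%:R) *+ lk /\
  st_n st' u v = (st_n st u v + (ku != kv) * lk)%N.
Proof.
rewrite /= /step /=; set L := display _ _ _ _.
have [-> ->] := foldl_upd_stats L (fun k => X (L, k) && A (L k))
  (st_s st, st_n st) (pairs K t) u v.
by rewrite count_link linked_display !posK.
Qed.

Definition wf st :=
  [/\ forall u v, st_s st v u = - st_s st u v,
      forall u v, st_n st v u = st_n st u v
    & forall u v, st_s st u v <= (st_n st u v)%:Z].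

Lemma wf_init R0 : wf (init_state R0).
Proof. by split. Qed.

Lemma wf_step st t coins A X : wf st -> wf (step delta st t coins A X).
Proof.
case=> h1 h2 h3; split=> u v.
- have [-> _] := step_stats st t coins A X u v.
  have [-> _] := step_stats st t coins A X v u.
  rewrite h1 [linked t _ (pos _ v)]linkedC.
  by case: (linked _ _ _); rewrite ?mulr1n ?mulr0n ?addr0 // opprD opprB.
- have [_ ->] := step_stats st t coins A X u v.
  have [_ ->] := step_stats st t coins A X v u.
  by rewrite h2 [linked t _ (pos _ v)]linkedC eq_sym.
- have [-> ->] := step_stats st t coins A X u v.
  have := h3 u v; set k := click _ _ _ _ _ u; set k' := click _ _ _ _ _ v.
  by case: (linked _ _ _); case: k; case: k' => /=; rewrite ?mulr1n ?mulr0n; lia.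
Qed.

Lemma wf_s0 st u v : wf st -> st_n st u v = 0%N -> st_s st u v = 0.
Proof.
case=> h1 h2 h3 e; have a := h3 u v; have := h3 v u.
by rewrite h1 h2; rewrite e in a *; lia.
Qed.

Lemma step_n_le st t coins A X u v :
  (st_n (step delta st t coins A X) u v <= (st_n st u v).+1)%N.
Proof.
have [_ ->] := step_stats st t coins A X u v.
by rewrite -addn1 leq_add2l; case: (_ != _); case: (linked _ _ _).
Qed.

End Algorithm.

(** * The bubble pass: inversions and neighbouring pairs *)

Section BubblePass.
Variables (R : realType) (K : nat) (delta : R).
Implicit Types (L B : {perm 'I_K}) (m : 'I_K -> 'I_K -> nat).

Lemma pos_swap B x y u : pos (swap_pos B x y) u = tperm x y (pos B u).
Proof. by rewrite /pos /swap_pos invMg tpermV permM. Qed.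

Lemma pos_swap_spec B (x y : 'I_K) u : y = x.+1 :> nat ->
  [\/ pos B u = x /\ pos (swap_pos B x y) u = y,
      pos B u = y /\ pos (swap_pos B x y) u = x
    | [/\ pos B u <> x :> nat, pos B u <> y :> nat
        & pos (swap_pos B x y) u = pos B u]].
Proof.
move=> e; rewrite pos_swap; case: tpermP => [->|->|h1 h2].
- by constructor 1.
- by constructor 2.
- by constructor 3; split=> // h; [apply: h1|apply: h2]; apply: val_inj.
Qed.

(** Exchanging neighbours alters the relative order of these two items only, and that order was
    wrong. *)
Lemma Vset_swap B (x y : 'I_K) : y = x.+1 :> nat -> (B y < B x)%N ->
  (#|Vset (swap_pos B x y)| < #|Vset B|)%N.
Proof.
move=> e lt; apply: proper_card; apply/properP; split; last first.
  exists (B y, B x); rewrite inE /= -/(pos _ _) -/(pos _ _) lt /=.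
    by rewrite !pos_perm e.
  by rewrite !pos_swap !pos_perm tpermL tpermR e -leqNgt leqnSn.
apply/subsetP => -[i j]; rewrite !inE /= -!/(pos _ _) => /andP[ij h].
rewrite ij /=.
have [[i1 i2]|[i1 i2]|[i1 i2 i3]] := pos_swap_spec B i e;
have [[j1 j2]|[j1 j2]|[j1 j2 j3]] := pos_swap_spec B j e;
  move: h; rewrite ?i2 ?j2 ?i3 ?j3 ?i1 ?j1; try by lia.
move=> _; move: ij; rewrite -(posK B i) -(posK B j) i1 j1.
by move: lt; lia.
Qed.

Definition adjacent (a b : nat) := (b == a.+1) || (a == b.+1).

(** Pairs compared so far together with the neighbours of the base list: no other pair can have a
    comparison after the next round. *)
Definition seen m B : {set 'I_K * 'I_K} :=
  [set ij : 'I_K * 'I_K | (ij.1 < ij.2)%N &&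
     ((m ij.1 ij.2 != 0)%N || adjacent (pos B ij.1) (pos B ij.2))].

Lemma seen_sub m m' B :
  (forall i j : 'I_K, (i < j)%N -> (i, j) \notin seen m B -> m' i j = 0%N) ->
  seen m' B \subset seen m B.
Proof.
move=> m0; apply/subsetP => -[i j]; apply: contraLR => h.
rewrite inE /=; apply/negP => /andP[ij]; rewrite m0 //= => adj.
by move: h; rewrite inE /= ij adj orbT.
Qed.

Definition ordered (u v : 'I_K) := if (u < v)%N then (u, v) else (v, u).

Lemma ordered_lt (u v : 'I_K) : (u < v)%N -> ordered u v = (u, v) /\ ordered v u = (u, v).
Proof. by move=> h; rewrite /ordered h ltnNge ltnW. Qed.

(** The only new neighbours after the exchange are the item before [x] with [B y], and the item
    after [y] with [B x]. *)
Lemma seen_swap m B (x y : 'I_K) : y = x.+1 :> nat ->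
  (#|seen m (swap_pos B x y)| <= #|seen m B| + 2)%N.
Proof.
(* At the ends of the list [z1] falls back to [x] and [z2] to [y]; the covering set then only
   contains a harmless extra pair. *)
move=> e; pose z1 : 'I_K := insubd x x.-1; pose z2 : 'I_K := insubd y y.+1.
have sub : seen m (swap_pos B x y) \subset
  seen m B :|: [set ordered (B z1) (B y); ordered (B z2) (B x)].
  apply/subsetP => -[i j]; rewrite !inE /= => /andP[ij h]; rewrite ij /=.
  case: (boolP (m i j != 0)%N) h => //= _ h.
  have key (a b : 'I_K) : pos (swap_pos B x y) a = pos B a ->
      pos B a <> x :> nat -> pos B a <> y :> nat ->
      adjacent (pos (swap_pos B x y) a) (pos (swap_pos B x y) b) ->
      ~~ adjacent (pos B a) (pos B b) ->
      (a = B z1 /\ b = B y) \/ (a = B z2 /\ b = B x).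
    move=> ea ax ay; rewrite ea.
    have [[b1 b2]|[b1 b2]|[b1 b2 b3]] := pos_swap_spec B b e.
    - rewrite b2 b1 /adjacent => h1 h2; right; split; last by rewrite -b1 posK.
      rewrite -(posK B a); congr (B _); apply: val_inj.
      have ea' : pos B a = y.+1 :> nat by lia.
      by rewrite val_insubd -ea' ltn_ord.
    - rewrite b2 b1 /adjacent => h1 h2; left; split; last by rewrite -b1 posK.
      rewrite -(posK B a); congr (B _); apply: val_inj.
      have ea' : pos B a = x.-1 :> nat by lia.
      by rewrite val_insubd -ea' ltn_ord.
    - by rewrite b3 => ->.
  have adjC a b : adjacent a b = adjacent b a by rewrite /adjacent orbC.
  case: (boolP (adjacent (pos B i) (pos B j))) => //= nadj.
  have [o1 o2] := ordered_lt ij.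
  have [i3|j3] : pos (swap_pos B x y) i = pos B i /\ pos B i <> x :> nat /\ pos B i <> y :> nat
    \/ pos (swap_pos B x y) j = pos B j /\ pos B j <> x :> nat /\ pos B j <> y :> nat.
  - have [[i1 i2]|[i1 i2]|[i1 i2 i3]] := pos_swap_spec B i e; last by left.
    + have [[j1 j2]|[j1 j2]|[j1 j2 j3]] := pos_swap_spec B j e; last by right.
        by move: ij; rewrite (pos_inj (etrans i1 (esym j1))) ltnn.
      by move: nadj; rewrite i1 j1 /adjacent e eqxx.
    + have [[j1 j2]|[j1 j2]|[j1 j2 j3]] := pos_swap_spec B j e; last by right.
        by move: nadj; rewrite i1 j1 /adjacent e eqxx orbT.
      by move: ij; rewrite (pos_inj (etrans i1 (esym j1))) ltnn.
  - case: i3 => i3 [i1 i2]; have [[<- <-]|[<- <-]] := key i j i3 i1 i2 h nadj.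
      by rewrite o1 eqxx.
    by rewrite o1 eqxx orbT.
  - rewrite adjC in h; rewrite adjC in nadj.
    case: j3 => i3 [i1 i2]; have [[<- <-]|[<- <-]] := key j i i3 i1 i2 h nadj.
      by rewrite o2 eqxx.
    by rewrite o2 eqxx orbT.
apply: leq_trans (subset_leq_card sub) _.
apply: leq_trans (leq_card_setU _ _) _.
by rewrite leq_add2l cards2; case: (_ != _).
Qed.

Definition bubble_step (s : 'I_K -> 'I_K -> int) m B (p : nat) :=
  if opair K p is Some (x, y) then
    if ~~ ltest delta (s (B y) (B x)) (m (B y) (B x)) then swap_pos B x y else B
  else B.

(** Since resolved pairs are in the right order, each exchange removes an inversion and adds at most
    two pairs to [seen], so the weighted sum cannot grow. A pass without any exchange certifies that
    no visited neighbours are resolved against their order in the list. *)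
Lemma foldl_bubble s m ps B :
  (forall u v, ~~ ltest delta (s u v) (m u v) -> (u < v)%N) ->
  let B' := foldl (bubble_step s m) B ps in
  (#|seen m B'| + 2 * #|Vset B'| <= #|seen m B| + 2 * #|Vset B|)%N /\
  ((#|Vset B'| < #|Vset B|)%N \/
   B' = B /\ (forall x y : 'I_K, y = x.+1 :> nat -> (x : nat) \in ps ->
     ltest delta (s (B y) (B x)) (m (B y) (B x)))).
Proof.
move=> res; elim: ps B => [|p ps IH] B /=; first by split=> //; right.
have [[x [y [exy nl e]]]|[e hp]] :
    (exists x y : 'I_K, [/\ y = x.+1 :> nat,
       ~~ ltest delta (s (B y) (B x)) (m (B y) (B x))
       & bubble_step s m B p = swap_pos B x y]) \/
    (bubble_step s m B p = B /\ forall x y : 'I_K, y = x.+1 :> nat -> x = p :> nat ->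
       ltest delta (s (B y) (B x)) (m (B y) (B x))).
- rewrite /bubble_step; case: opairP => [x y ex ey|Kp].
    case: ifP => [nl|/negbFE le]; [left|right].
      by exists x, y; rewrite ey ex.
    split=> // x' y' ey' ex'.
    have -> : x' = x by apply: val_inj; rewrite /= ex' ex.
    by have -> : y' = y by apply: val_inj; rewrite /= ey' ex' ey.
  right; split=> // x y ey ex.
  by move: (ltn_ord y); rewrite ey ex ltnNge Kp.
- have v := Vset_swap exy (res _ _ nl); have w := seen_swap m B exy.
  rewrite e; have [h1 h2] := IH (swap_pos B x y).
  split.
    apply: leq_trans h1 _; apply: leq_trans (leq_add w (leqnn _)) _.
    by rewrite -addnA leq_add2l -mulnS leq_mul2l.
  by left; case: h2 => [/ltn_trans|[-> _]] //; apply.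
- rewrite e; have [h1 h2] := IH B; split=> //.
  case: h2 => [|[h2 h3]]; [by left|right; split=> // x y ey].
  by rewrite inE => /orP[/eqP|]; [exact: hp|exact: h3].
Qed.

Lemma upd_baseP s m B :
  (forall u v, ~~ ltest delta (s u v) (m u v) -> (u < v)%N) ->
  let B' := upd_base delta s m B in
  (#|seen m B'| + 2 * #|Vset B'| <= #|seen m B| + 2 * #|Vset B|)%N /\
  ((#|Vset B'| < #|Vset B|)%N \/
   B' = B /\ (forall x y : 'I_K, y = x.+1 :> nat ->
     ltest delta (s (B y) (B x)) (m (B y) (B x)))).
Proof.
move=> res; have [h1 h2] := foldl_bubble (iota 0 K) B res; split=> //.
case: h2 => [|[h2 h3]]; [by left|right; split=> // x y e].
by apply: h3; rewrite // mem_iota /= add0n.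
Qed.

Lemma card_seen_init B : (0 < K)%N -> (#|seen (fun _ _ => 0%N) B| <= K.-1)%N.
Proof.
move=> K0; pose f (x : 'I_K) := ordered (B x) (B (insubd x x.+1)).
have -> : K.-1 = #|[set x : 'I_K | (x != K.-1 :> nat)]|.
  have KK : (K.-1 < K)%N by rewrite ltn_predL.
  have -> : [set x : 'I_K | (x != K.-1 :> nat)] = [set~ Ordinal KK].
    by apply/setP => x; rewrite !inE -val_eqE.
  by rewrite cardsC1 card_ord.
apply: leq_trans (leq_imset_card f _); apply: subset_leq_card.
apply/subsetP => -[i j]; rewrite !inE /= => /andP[ij h].
have [o1 o2] := ordered_lt ij.
have key (a b : 'I_K) : pos B b = (pos B a).+1 :> nat ->
    (pos B a != K.-1 :> nat) /\ f (pos B a) = ordered a b.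
  move=> e; have := ltn_ord (pos B b); rewrite e => lt; split; first by lia.
  rewrite /f posK; congr ordered; rewrite -[RHS](posK B); congr (B _).
  by apply: val_inj; rewrite /= val_insubd lt e.
case/orP: h => /eqP /key[h1 h2]; apply/imsetP.
  by exists (pos B i); rewrite ?inE // h2.
by exists (pos B j); rewrite ?inE // h2.
Qed.

End BubblePass.

(** * Click bandits: examination probabilities and drift of the clicks *)

Lemma bigmin_seq_le (R : realType) (T : eqType) (s : seq T) (F : T -> R) x0 p :
  p \in s -> \big[Num.min/x0]_(q <- s) F q <= F p.
Proof.
elim: s => // q s IH; rewrite inE big_cons ge_min => /orP[/eqP ->|/IH ->].
  by rewrite lexx.
by rewrite orbT.
Qed.

Record click_bandit (R : realType) (K : nat) (Pa : attr_vec K -> R)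
    (Pc : exam_mat K -> R) : Prop := ClickBandit {
  cb_pmfA : is_pmf Pa;
  cb_pmfC : is_pmf Pc;
  cb_A1 : A1 (alpha Pa) (chi Pc);
  cb_A2 : A2 (chi Pc);
  cb_A3 : A3 (chi Pc);
  cb_A4 : A4 (alpha Pa) (chi Pc);
  cb_A5 : A5 (chi Pc);
  cb_dec : forall i j : 'I_K, (i < j)%N -> alpha Pa j < alpha Pa i;
  cb_min : 0 < chi_min (chi Pc) }.

Section Bandit.
Variables (R : realType) (K : nat) (Pa : attr_vec K -> R) (Pc : exam_mat K -> R).
Variable delta : R.
Hypothesis ok : click_bandit Pa Pc.
Let pmfA := cb_pmfA ok.
Let pmfC := cb_pmfC ok.
Let a2 := cb_A2 ok.
Let a3 := cb_A3 ok.
Let a4 := cb_A4 ok.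
Let a5 := cb_A5 ok.
Let adec := cb_dec ok.
Let cmin0 := cb_min ok.
Implicit Types (st : bstate K) (L B : {perm 'I_K}) (t : nat) (coins : coin_vec K).

Notation a := (alpha Pa).
Notation c := (chi Pc).
Notation outcome := (coin_vec K * attr_vec K * exam_mat K)%type.

Definition mu (w : outcome) : R := (2 ^+ K)^-1 * Pa w.1.2 * Pc w.2.

Lemma Ex_mu (F : coin_vec K -> attr_vec K -> exam_mat K -> R) :
  \sum_(coins : coin_vec K) (2 ^+ K)^-1 *
    \sum_(A : attr_vec K) Pa A * \sum_(X : exam_mat K) Pc X * F coins A X
  = Ex mu (fun w => F w.1.1 w.1.2 w.2).
Proof.
rewrite /Ex -(pair_bigA _ (fun q X => mu (q, X) * F q.1 q.2 X)) /=.
rewrite -(pair_bigA _ (fun x A => \sum_(X : exam_mat K) mu ((x, A), X) * F x A X)) /=.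
apply: eq_bigr => x _; rewrite mulr_sumr; apply: eq_bigr => A _.
by rewrite !mulr_sumr; apply: eq_bigr => X _; rewrite /mu /= !mulrA.
Qed.

Lemma sum_coins : \sum_(coins : coin_vec K) (2 ^+ K)^-1 = 1 :> R.
Proof.
rewrite sumr_const card_ffun card_bool card_ord -[LHS]mulr_natr natrX mulVf //.
by rewrite expf_neq0 // pnatr_eq0.
Qed.

Lemma mu_pmf : is_pmf mu.
Proof.
split=> [w|].
  by rewrite /mu !mulr_ge0 ?pmfA.1 ?pmfC.1 // invr_ge0 exprn_ge0 // ler0n.
have := Ex_mu (fun _ _ _ => 1); rewrite /Ex.
under [in RHS]eq_bigr do rewrite mulr1.
move=> <-; rewrite -[RHS]sum_coins; apply: eq_bigr => x _.
under eq_bigr => A _ do (under eq_bigr do rewrite mulr1).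
by rewrite pmfC.2; under eq_bigr do rewrite mulr1; rewrite pmfA.2 mulr1.
Qed.

Lemma alpha_ge0 i : 0 <= a i.
Proof. by apply: sumr_ge0 => A _; rewrite mulr_ge0 ?pmfA.1. Qed.

Lemma alpha_le1 i : a i <= 1.
Proof.
rewrite -pmfA.2; apply: ler_sum => A _.
by rewrite ler_piMr ?pmfA.1 // lern1 leq_b1.
Qed.

Lemma chi_ge0 L k : 0 <= c L k.
Proof. by apply: sumr_ge0 => A _; rewrite mulr_ge0 ?pmfC.1. Qed.

Lemma chi_le1 L k : c L k <= 1.
Proof.
rewrite -pmfC.2; apply: ler_sum => A _.
by rewrite ler_piMr ?pmfC.1 // lern1 leq_b1.
Qed.

(** The probability that item [u] is examined in round [t], averaged over the coins; by independence
    the click probability is its product with the attraction. *)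
Definition exam st t u : R :=
  \sum_(coins : coin_vec K) (2 ^+ K)^-1 *
    c (display delta st t coins) (pos (display delta st t coins) u).

Lemma Ex_click st t u :
  Ex mu (fun w => (click delta st t w.1.1 w.1.2 w.2 u)%:R) = a u * exam st t u.
Proof.
rewrite -(Ex_mu (fun x A X => (click delta st t x A X u)%:R)) /exam mulr_sumr.
apply: eq_bigr => x _; rewrite mulrCA; congr (_ * _).
rewrite /alpha mulr_suml; apply: eq_bigr => A _; rewrite -mulrA; congr (_ * _).
rewrite /chi mulr_sumr; apply: eq_bigr => X _; rewrite /click mulrCA; congr (_ * _).
by rewrite -natrM mulnb andbC.
Qed.

Notation D := (Delta_min a).

Lemma K_gt0 : (0 < K)%N.
Proof.
case: (posnP K) => // K0; move: cmin0; rewrite /chi_min.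
case: insubP => [x|_]; last by rewrite ltxx.
by have : (x < 0)%N by rewrite -[X in (_ < X)%N]K0.
Qed.

Lemma chi_min_le L k : chi_min c <= c L k.
Proof.
rewrite /chi_min; case: insubP => [x _ ex|]; last by rewrite ltn_predL K_gt0.
apply: le_trans (a5 _ _).
have : (k <= x)%N by rewrite ex -ltnS prednK ?K_gt0.
rewrite leq_eqVlt => /orP[/eqP/val_inj -> //|]; exact: a3.
Qed.

Lemma chi_le_max L k : c L k <= chi_max c.
Proof.
rewrite /chi_max; case: insubP => [x _ ex|]; last by rewrite K_gt0.
have <- : c L x = c 1%g x.
  apply: a2; suff -> : [set j : 'I_K | (j < x)%N] = set0 by rewrite !imset0.
  by apply/setP => j; rewrite !inE ex ltn0.
case: (posnP k) => k0; first by have -> : k = x by apply: val_inj; rewrite /= k0 ex.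
by apply: a3; rewrite ex.
Qed.

Lemma chi_max_le1 : chi_max c <= 1.
Proof. by rewrite /chi_max; case: insub => [x|]; [exact: chi_le1|exact: ler01]. Qed.

Lemma chi_max_gt0 : 0 < chi_max c.
Proof.
apply: lt_le_trans cmin0 _.
exact: le_trans (chi_min_le 1%g (Ordinal K_gt0)) (chi_le_max _ _).
Qed.

Lemma Delta_le1 : D <= 1.
Proof.
rewrite /Delta_min; elim: (iota 0 K) => [|p s IH]; first by rewrite big_nil.
by rewrite big_cons ge_min IH orbT.
Qed.

Lemma Delta_gt0 : 0 < D.
Proof.
rewrite /Delta_min; elim: (iota 0 K) => [|p s IH]; first by rewrite big_nil.
rewrite big_cons lt_min IH andbT; case: opairP => // x y ex ey.
by rewrite subr_gt0 adec // ex ey.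
Qed.

Lemma alpha_anti (i j : 'I_K) : (i <= j)%N -> a j <= a i.
Proof. by rewrite leq_eqVlt => /orP[/eqP/val_inj ->|/adec/ltW]. Qed.

Lemma Delta_le (i j : 'I_K) : (i < j)%N -> D <= a i - a j.
Proof.
move=> ij; have iK : (i.+1 < K)%N by apply: leq_ltn_trans ij (ltn_ord j).
have : D <= a i - a (Ordinal iK).
  have := @bigmin_seq_le R _ (iota 0 K)
    (fun p => if opair K p is Some (x, y) then a x - a y else 1) 1 i.
  rewrite mem_iota /= add0n ltn_ord => /(_ isT) h; apply: le_trans h _.
  case: opairP => [x y ex ey|]; last by rewrite leqNgt iK.
  have -> : x = i by apply: val_inj.
  by have -> : y = Ordinal iK by apply: val_inj.
move/le_trans; apply; rewrite lerD2l lerN2; exact: alpha_anti.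
Qed.

(** By A2 the upper position is examined equally in both lists; by A4 the lower one is examined at
    least as often when the better item stands there. Over the two orders together, the better item
    is thus examined no less than the other. *)
Lemma chi_swap_pair L (x y : 'I_K) : y = x.+1 :> nat -> a (L y) <= a (L x) ->
  c L y + c (swap_pos L x y) x <= c L x + c (swap_pos L x y) y.
Proof.
move=> e le; set L' := swap_pos L x y.
have xy : (x < y)%N by rewrite e.
have -> : c L' x = c L x.
  apply: a2; apply: eq_in_imset => j; rewrite inE => jx.
  rewrite /L' /swap_pos permM tpermD //; apply/eqP => ej; rewrite -ej in jx.
    by rewrite ltnn in jx.
  by move: (ltn_trans jx xy); rewrite ltnn.
rewrite addrC lerD2l.
have eL : L = swap_pos L' x y.
  by apply/permP => z; rewrite /L' /swap_pos !permM tpermK.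
apply/(a4 xy eL); rewrite /L' /swap_pos !permM tpermL tpermR.
exact: le.
Qed.

Lemma exam_ge st t u : chi_min c <= exam st t u.
Proof.
rewrite -[leLHS]mul1r -sum_coins mulr_suml; apply: ler_sum => x _.
by rewrite ler_wpM2l ?chi_min_le // invr_ge0 exprn_ge0 // ler0n.
Qed.

Lemma pos_eq L i x : L x = i -> pos L i = x.
Proof. by move=> <-; rewrite pos_perm. Qed.

Lemma exam_le_flip st t (x y i j : 'I_K) :
  y = x.+1 :> nat -> odd x == odd t ->
  unres delta st (st_base st x) (st_base st y) -> a j <= a i ->
  (st_base st x = i /\ st_base st y = j) \/ (st_base st x = j /\ st_base st y = i) ->
  exam st t j <= exam st t i.
Proof.
move=> e o un le bij.
pose F u coins := (2 ^+ K)^-1 *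
    c (display delta st t coins) (pos (display delta st t coins) u).
(* Each coin vector is matched with its flip at [x], so that [chi_swap_pair] applies to every couple
   of displayed lists. *)
have dbl u : exam st t u *+ 2 = \sum_coins (F u coins + F u (flip coins x)).
  rewrite big_split mulr2n; congr (_ + _).
  by rewrite /exam (reindex_inj (inv_inj (flipK x))).
rewrite -(@ler_pMn2r _ 2) // !dbl; apply: ler_sum => coins _.
rewrite /F (display_flip coins e o un); set L := display _ _ _ _.
rewrite -!mulrDr; apply: ler_wpM2l; first by rewrite invr_ge0 exprn_ge0 // ler0n.
have lk : linked t x y by rewrite /linked e eqxx o.
have : (L x = i /\ L y = j) \/ (L x = j /\ L y = i).
  have /= := display_linked delta st coins lk; rewrite -/L.
  by case: bij => -[-> ->]; case=> -[-> ->]; by [left|right].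
have Lx : swap_pos L x y x = L y by rewrite /swap_pos permM tpermL.
have Ly : swap_pos L x y y = L x by rewrite /swap_pos permM tpermR.
case=> -[ex ey].
  rewrite (pos_eq ex) (pos_eq ey).
  rewrite (@pos_eq (swap_pos L x y) i y) ?Ly // (@pos_eq (swap_pos L x y) j x) ?Lx //.
  by apply: chi_swap_pair => //; rewrite ex ey.
rewrite (pos_eq ex) (pos_eq ey).
rewrite (@pos_eq (swap_pos L x y) i x) ?Lx // (@pos_eq (swap_pos L x y) j y) ?Ly //.
have := @chi_swap_pair (swap_pos L x y) x y e.
rewrite Lx Ly ex ey (_ : swap_pos (swap_pos L x y) x y = L); last first.
  by apply/permP => z; rewrite /swap_pos !permM tpermK.
by move/(_ le); rewrite addrC [leRHS]addrC.
Qed.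

Definition correct st := forall u v, ~~ unres delta st u v -> (u < v)%N.

(** If the pair is unresolved, the coin symmetrises the two orders. If it is resolved, then
    correctness puts the better item first in the base list and A3 applies. *)
Lemma exam_le st t (i j : 'I_K) : correct st -> (i < j)%N ->
  linked t (pos (st_base st) i) (pos (st_base st) j) ->
  exam st t j <= exam st t i.
Proof.
move=> cor ij /orP[] /andP[/eqP e o]; have le := ltW (adec ij).
  case: (boolP (unres delta st i j)) => un.
    by apply: (exam_le_flip e o _ le); [|left]; rewrite !posK.
  apply: ler_sum => coins _; apply: ler_wpM2l.
    by rewrite invr_ge0 exprn_ge0 // ler0n.
  have := display_pair delta st coins e o; rewrite /= !posK (negbTE un) /=.
  case=> /pos_eq -> /pos_eq ->; apply: a3; by rewrite e.
apply: (exam_le_flip e o _ le); last by right; rewrite !posK.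
rewrite !posK; apply: contraLR ij => /cor; rewrite -leqNgt; exact: ltnW.
Qed.

Notation clk st t u := (fun w : outcome => click delta st t w.1.1 w.1.2 w.2 u).

(** Both parts compare the click probabilities [a i * exam i] and [a j * exam j], where [j] is
    examined at most as often as [i], and [i] with probability at least [chi_min]. *)
Lemma click_drift st t (i j : 'I_K) : correct st -> (i < j)%N ->
  linked t (pos (st_base st) i) (pos (st_base st) j) ->
  only mu (clk st t j) (clk st t i) <= (1 - D) * only mu (clk st t i) (clk st t j) /\
  chi_min c * (a i - a j) <=
    only mu (clk st t i) (clk st t j) - only mu (clk st t j) (clk st t i).
Proof.
move=> cor ij lk; have le := exam_le cor ij lk.
have d0 := ltW Delta_gt0; have d1 := Delta_le1.
have dl := Delta_le ij; have g := exam_ge st t i.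
have ai1 := alpha_le1 i; have ai0 := alpha_ge0 i; have aj0 := alpha_ge0 j.
have h : a j * exam st t j <= a j * exam st t i by exact: ler_wpM2l.
have g0 : 0 <= exam st t i by apply: le_trans g; exact: ltW.
split.
  apply: (only_le mu_pmf) => //; rewrite !Ex_click.
  (* Since [a i <= 1], the additive gap [a j <= a i - D] yields the factor
     [a j <= (1 - D) * a i]. *)
  apply: le_trans h _; rewrite mulrA ler_wpM2r //; nra.
rewrite onlyB !Ex_click.
have : chi_min c * (a i - a j) <= exam st t i * (a i - a j).
  by apply: ler_wpM2r => //; apply: le_trans dl.
by move=> h2; nra.
Qed.

End Bandit.

(** * Concentration: good states and the failure supermartingale *)

Section Concentration.
Variables (R : realType) (K : nat) (Pa : attr_vec K -> R) (Pc : exam_mat K -> R).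
Variable delta : R.
Hypothesis ok : click_bandit Pa Pc.
Hypothesis d01 : 0 < delta < 1.
Implicit Types (st : bstate K) (t : nat) (i j u v : 'I_K).

Notation D := (Delta_min (alpha Pa)).
Notation LD := (ln delta^-1).
Notation mu := (mu Pa Pc).
Notation outcome := (coin_vec K * attr_vec K * exam_mat K)%type.
Notation stp st t w := (step delta st t w.1.1 w.1.2 w.2).

Lemma LD_gt0 : 0 < LD.
Proof. by case/andP: d01 => d0 d1; rewrite ln_gt0 // invf_gt1. Qed.

Lemma sqrt_delta_exp : Num.sqrt delta * expR (LD / 2) = 1.
Proof.
case/andP: d01 => d0 _.
have e2 : expR (LD / 2) ^+ 2 = delta^-1.
  by rewrite expr2 -expRD -splitr lnK // posrE invr_gt0.
apply/eqP; rewrite -sqrp_eq1 ?mulr_ge0 ?sqrtr_ge0 ?expR_ge0 //.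
by rewrite exprMn sqr_sqrtr ?ltW // e2 mulfV // lt0r_neq0.
Qed.

Definition good st : bool :=
  [forall i : 'I_K, forall j : 'I_K, (i < j)%N ==>
    (D / 2 * (st_n st i j)%:R - 2 * Num.sqrt ((st_n st i j)%:R * LD)
      <= (st_s st i j)%:~R)].

Lemma goodP st : reflect (forall i j, (i < j)%N ->
    D / 2 * (st_n st i j)%:R - 2 * Num.sqrt ((st_n st i j)%:R * LD)
      <= (st_s st i j)%:~R) (good st).
Proof.
apply: (iffP forallP) => h i.
  by move=> j ij; have /forallP/(_ j)/implyP := h i; apply.
by apply/forallP => j; apply/implyP; exact: h.
Qed.

(** A pair resolved the wrong way would push the score of the better item below [- 2 * sqrt (n L)],
    hence below its band. *)
Lemma good_correct st : wf st -> good st -> correct delta st.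
Proof.
case=> w1 w2 w3 /goodP g u v; rewrite /unres /ltest -ltNge => lt.
case: (ltngtP u v) => // [vu|/val_inj e].
  have := g _ _ vu; rewrite w1 (w2 u v) rmorphN /= => le.
  have : 0 <= D / 2 * (st_n st u v)%:R.
    by rewrite mulr_ge0 ?ler0n // divr_ge0 // ltW // (Delta_gt0 ok).
  by move: lt le; set q := Num.sqrt _; lra.
have s0 : st_s st v v = 0 by have := w1 v v; lia.
by move: lt; rewrite e s0; have := sqrtr_ge0 ((st_n st v v)%:R * LD); lra.
Qed.

(** For [m >= L] this maximises [2 * th * sqrt (m L) - 2 * th ^+ 2 * m], with maximum [L / 2]. For
    smaller [m] no score can leave its band, and the value 0 keeps the exponent below [2^-1]. *)
Definition theta (m : nat) : R :=
  if LD <= m%:R then Num.sqrt (LD / m%:R) / 2 else 0.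

Lemma theta_ge0 m : 0 <= theta m.
Proof. by rewrite /theta; case: ifP => // _; rewrite divr_ge0 ?sqrtr_ge0. Qed.

Lemma theta_le m : theta m <= 2^-1.
Proof.
rewrite /theta; case: ifP => [h|_]; last by rewrite invr_ge0.
rewrite -[leRHS]mul1r ler_wpM2r ?invr_ge0 // -[leRHS]sqrtr1 ler_wsqrtr //.
have m0 : 0 < m%:R :> R by apply: lt_le_trans LD_gt0 h.
by rewrite ler_pdivrMr // mul1r.
Qed.

Definition wexp (th : R) (s : int) (n : nat) : R :=
  expR (- th * s%:~R + (D / 2 * th - 2 * th ^+ 2) * n%:R).

(* A sum of exponential supermartingales, one per pair and per number of
   comparisons; it is at least 1 as soon as some score leaves its confidence
   band. *)
Definition failure (N : nat) st : R :=
  Num.sqrt delta * \sum_(ij : 'I_K * 'I_K | (ij.1 < ij.2)%N) \sum_(m < N)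
    wexp (theta m.+1) (st_s st ij.1 ij.2) (st_n st ij.1 ij.2).

Lemma failure_ge0 N st : 0 <= failure N st.
Proof.
rewrite mulr_ge0 ?sqrtr_ge0 // sumr_ge0 // => ij _; rewrite sumr_ge0 // => m _.
exact: expR_ge0.
Qed.

Lemma Ex_wexp st t (th : R) i j : wf st -> good st -> (i < j)%N -> 0 <= th -> th <= 2^-1 ->
  Ex mu (fun w => wexp th (st_s (stp st t w) i j) (st_n (stp st t w) i j))
  <= wexp th (st_s st i j) (st_n st i j).
Proof.
move=> wst gst ij t0 t2; have cor := good_correct wst gst.
pose lk := linked t (pos (st_base st) i) (pos (st_base st) j).
pose k u (w : outcome) := click delta st t w.1.1 w.1.2 w.2 u.
pose h (b b' : bool) := wexp th (st_s st i j + ((b%:R : int) - b'%:R) *+ lk)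
   (st_n st i j + (b != b') * lk)%N.
rewrite (_ : Ex mu _ = Ex mu (fun w => h (k i w) (k j w))); last first.
  by apply: eq_Ex => w; have [-> ->] := step_stats delta st t w.1.1 w.1.2 w.2 i j.
have [lkT|/negbTE lkF] := boolP lk; last first.
  rewrite (@eq_Ex _ _ _ _ (fun=> wexp th (st_s st i j) (st_n st i j))).
    by rewrite (Ex_cst (mu_pmf ok)).
  by move=> w; rewrite /h lkF mulr0n muln0 addr0 addn0.
have dr : only mu (k j) (k i) <= (1 - D) * only mu (k i) (k j).
  by have [] := click_drift ok cor ij lkT.
rewrite (Ex_clicks (mu_pmf ok)); last by rewrite /h lkT.
have h00 : h false false = wexp th (st_s st i j) (st_n st i j).
  by rewrite /h lkT subrr mul0rn addr0 addn0.
set b := wexp _ _ _ in h00 *; rewrite h00 -[leRHS]addr0 lerD2l.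
have h10 : h true false = b * expR (- th + (D / 2 * th - 2 * th ^+ 2)).
  rewrite /h lkT subr0 mulr1n muln1 /= /b /wexp -expRD; congr expR.
  by rewrite rmorphD /= natrD; ring.
have h01 : h false true = b * expR (th + (D / 2 * th - 2 * th ^+ 2)).
  rewrite /h lkT sub0r mulr1n muln1 /= /b /wexp -expRD; congr expR.
  by rewrite rmorphD /= rmorphN /= natrD; ring.
rewrite h10 h01.
set p := only mu (k i) (k j) in dr *; set r := only mu (k j) (k i) in dr *.
have p0 : 0 <= p by exact: only_ge0 (mu_pmf ok) _ _.
have r0 : 0 <= r by exact: only_ge0 (mu_pmf ok) _ _.
have dri := exp_drift (ltW (Delta_gt0 ok)) t0 t2 p0 r0 dr.
have b0 : 0 <= b by exact: expR_ge0.
set e1 := expR (- th + _) in dri *; set e2 := expR (th + _) in dri *.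
have -> : p * (b * e1 - b) + r * (b * e2 - b) = b * (p * (e1 - 1) + r * (e2 - 1)) by ring.
by rewrite mulr_ge0_le0.
Qed.

Lemma Ex_failure N st t : wf st -> good st ->
  Ex mu (fun w => failure N (stp st t w)) <= failure N st.
Proof.
move=> wst gst; rewrite ExZ ler_wpM2l ?sqrtr_ge0 // Ex_sum; apply: ler_sum => ij h.
rewrite Ex_sum; apply: ler_sum => m _.
by apply: Ex_wexp => //; [exact: theta_ge0|exact: theta_le].
Qed.

(** The single term of the violating pair, taken at [theta n] for its own count [n], has exponent at
    least [L / 2], which cancels the factor [sqrt delta]. *)
Lemma failure_bad N st : wf st -> ~~ good st -> (forall u v, st_n st u v <= N)%N ->
  1 <= failure N st.
Proof.
move=> [w1 w2 w3] bad nN.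
have [i [j [ij lt]]] : exists i j, (i < j)%N /\ (st_s st i j)%:~R <
    D / 2 * (st_n st i j)%:R - 2 * Num.sqrt ((st_n st i j)%:R * LD).
  case/forallPn: bad => i /forallPn[j]; rewrite negb_imply -ltNge => /andP[ij h].
  by exists i, j.
set n := st_n st i j in lt *; set s := st_s st i j in lt *.
have sn : - n%:R <= s%:~R :> R.
  have : - n%:Z <= s by have := w3 j i; rewrite w1 w2 -/s -/n; lia.
  by rewrite -(ler_int R) rmorphN /=.
have L0 := LD_gt0; have D0 := Delta_gt0 ok; have D1 := Delta_le1 Pa.
pose q : R := Num.sqrt n%:R; pose l : R := Num.sqrt LD.
have q0 : 0 <= q by exact: sqrtr_ge0.
have l0 : 0 < l by rewrite sqrtr_gt0.
have qq : q ^+ 2 = n%:R by rewrite sqr_sqrtr // ler0n.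
have ll : l ^+ 2 = LD by rewrite sqr_sqrtr // ltW.
have eql : Num.sqrt (n%:R * LD) = q * l by rewrite sqrtrM // ler0n.
rewrite eql in lt.
(* A score is at least [- n], so it can fall below the band only if [n >= L]. *)
have lq : l <= q.
  rewrite leNgt; apply/negP => ql.
  have : q ^+ 2 <= q * l by rewrite expr2 ler_wpM2l // ltW.
  have : D * q ^+ 2 <= q ^+ 2 by rewrite ler_piMl // sqr_ge0.
  by rewrite qq => h1 h2; have := ler0n R n; lra.
have q1 : 0 < q by apply: lt_le_trans l0 lq.
have Ln : LD <= n%:R by rewrite -qq -ll ler_pXn2r // nnegrE ltW.
have n0 : (0 < n)%N by rewrite -(ltr_nat R); apply: lt_le_trans L0 Ln.
(* The sum runs over [theta m.+1], so the count [n] sits at index [n.-1]. *)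
have nN' : (n.-1 < N)%N by rewrite prednK //; exact: nN.
have th : theta n = l / q / 2.
  by rewrite /theta Ln sqrtrM ?ltW // sqrtrV ?ler0n.
rewrite /failure (bigD1 (i, j)) //= (bigD1 (Ordinal nN')) //=.
rewrite prednK // -/s -/n.
apply: (@le_trans _ _ (Num.sqrt delta * wexp (theta n) s n)); last first.
  rewrite ler_wpM2l ?sqrtr_ge0 // -addrA lerDl addr_ge0 //.
    by apply: sumr_ge0 => m _; exact: expR_ge0.
  apply: sumr_ge0 => ab _; apply: sumr_ge0 => m _; exact: expR_ge0.
rewrite -sqrt_delta_exp ler_wpM2l ?sqrtr_ge0 // ler_expR.
have t0 : 0 < theta n by rewrite th !divr_gt0.
have h : theta n * s%:~R <= theta n * (D / 2 * n%:R - 2 * (q * l)).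
  by rewrite ler_wpM2l // ltW.
have e1 : theta n * (q * l) = LD / 2.
  rewrite th -ll; field; exact: lt0r_neq0.
have e2 : theta n ^+ 2 * n%:R = LD / 4.
  rewrite th -ll -qq; field; exact: lt0r_neq0.
have -> : - theta n * s%:~R + (D / 2 * theta n - 2 * theta n ^+ 2) * n%:R =
  - (theta n * s%:~R) + theta n * (D / 2 * n%:R) - 2 * (theta n ^+ 2 * n%:R) by ring.
rewrite e2; move: h; rewrite mulrBr [theta n * (2 * _)]mulrCA e1 => h; lra.
Qed.

Lemma failure_init N R0 : failure N (init_state R0) <= Num.sqrt delta * (K%:R ^+ 2 * N%:R).
Proof.
rewrite ler_wpM2l ?sqrtr_ge0 //.
rewrite (eq_bigr (fun=> N%:R)); last first.
  move=> ij _; rewrite (eq_bigr (fun=> 1)) ?sumr_const ?card_ord // => m _.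
  by rewrite /wexp /= !mulr0 addr0 expR0.
rewrite sumr_const -[leLHS]mulr_natl ler_wpM2r ?ler0n // -natrX ler_nat.
by apply: leq_trans (max_card _) _; rewrite card_prod !card_ord.
Qed.

End Concentration.

(** * The regret of a round in terms of unresolved neighbours *)

Lemma ler_sum_image (R : realType) (I J : finType) (P : pred I) (Q : pred J)
    (f : I -> J) (F : J -> R) :
  {in P &, injective f} -> (forall x, P x -> Q (f x)) -> (forall z, Q z -> 0 <= F z) ->
  \sum_(x | P x) F (f x) <= \sum_(z | Q z) F z.
Proof.
move=> inj PQ F0.
have -> : \sum_(x | P x) F (f x) = \sum_(z in [set f x | x in P]) F z.
  by rewrite big_imset //=; apply: eq_bigl => x.
rewrite [leRHS](bigID [pred z | z \in [set f x | x in P]]) /=.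
have -> : \sum_(z in [set f x | x in P]) F z =
    \sum_(z | Q z && (z \in [set f x | x in P])) F z.
  apply: eq_bigl => z; apply/idP/andP => [h|[]//]; split=> //.
  by case/imsetP: h => x /PQ h ->.
by rewrite lerDl sumr_ge0 // => z /andP[/F0].
Qed.

Section StepRegret.
Variables (R : realType) (K : nat) (Pa : attr_vec K -> R) (Pc : exam_mat K -> R).
Variable delta : R.
Hypothesis ok : click_bandit Pa Pc.
Implicit Types (st : bstate K) (L B : {perm 'I_K}) (t : nat) (coins : coin_vec K).

Notation a := (alpha Pa).
Notation c := (chi Pc).

Lemma opt_rew_le : opt_rew a c <= rew a c 1%g.
Proof.
apply: bigmax_le => [|L _]; last exact: cb_A1 ok L.
by apply: sumr_ge0 => k _; rewrite mulr_ge0 ?(chi_ge0 ok) ?(alpha_ge0 ok).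
Qed.

(* Out-of-range neighbours are the position itself, so that differences between
   a position and its neighbour vanish at the ends. *)
Definition nxt (x : 'I_K) : 'I_K := insubd x x.+1.
Definition prv (x : 'I_K) : 'I_K := insubd x x.-1.

Lemma nxtE (x : 'I_K) : nxt x = (if (x.+1 < K)%N then x.+1 else x) :> nat.
Proof. exact: val_insubd. Qed.

Lemma prvE (x : 'I_K) : prv x = x.-1 :> nat.
Proof. by rewrite val_insubd; have := ltn_ord x; case: ifP => //; lia. Qed.

Lemma nxt_eq (x y : 'I_K) : y = x.+1 :> nat -> nxt x = y.
Proof. by move=> e; apply: val_inj; rewrite /= nxtE -e ltn_ord. Qed.

Lemma nxt_last (x : 'I_K) : (K <= x.+1)%N -> nxt x = x.
Proof. by move=> h; apply: val_inj; rewrite /= nxtE ltnNge h. Qed.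

Definition up L x : R := Num.max 0 (a (L (nxt x)) - a (L x)).

Lemma up_ge0 L x : 0 <= up L x.
Proof. by rewrite le_max lexx. Qed.

Definition ascent L : R := \sum_(x : 'I_K) up L x.

Lemma climb L (k y : 'I_K) : (k <= y)%N -> a (L y) - a (L k) <= ascent L.
Proof.
suff H m : forall y : 'I_K, y = m :> nat -> (k <= y)%N ->
    a (L y) - a (L k) <= \sum_(x : 'I_K | (x < m)%N) up L x.
  move=> ky; apply: le_trans (H _ y erefl ky) _.
  rewrite /ascent [leRHS](bigID (fun x : 'I_K => (x < y)%N)) /= lerDl.
  by apply: sumr_ge0 => x _; exact: up_ge0.
elim: m => [|m IH] z ez kz.
  have -> : k = z by apply: val_inj => /=; lia.
  by rewrite subrr sumr_ge0 // => x _; exact: up_ge0.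
move: kz; rewrite leq_eqVlt => /orP[/eqP/val_inj ->|kz].
  by rewrite subrr sumr_ge0 // => x _; exact: up_ge0.
have ep : prv z = m :> nat by rewrite prvE ez.
have en : nxt (prv z) = z by apply: nxt_eq; rewrite ep ez.
have kp : (k <= prv z)%N by rewrite ep; lia.
have h := IH _ ep kp.
rewrite (bigD1 (prv z)) /=; last by rewrite ep.
rewrite (eq_bigl (fun x : 'I_K => (x < m)%N)); last first.
  by move=> x; rewrite -val_eqE /= ep; lia.
have : a (L z) - a (L (prv z)) <= up L (prv z) by rewrite /up en le_max lexx orbT.
lra.
Qed.

Lemma ascent_ge0 L : 0 <= ascent L.
Proof. by apply: sumr_ge0 => x _; exact: up_ge0. Qed.

(** Pigeonhole: the [k + 1] best items do not fit into the [k] positions before [k]. *)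
Lemma late_item L (k : 'I_K) : exists2 y : 'I_K, (k <= y)%N & (L y <= k)%N.
Proof.
case: (boolP [exists y : 'I_K, (k <= y)%N && (L y <= k)%N]) => [/existsP[y /andP[]]|].
  by exists y.
rewrite negb_exists => /forallP h.
have sub : pos L @: [set i : 'I_K | (i <= k)%N] \subset [set x : 'I_K | (x < k)%N].
  apply/subsetP => x /imsetP[i]; rewrite !inE => ik ->.
  by have := h (pos L i); rewrite posK ik andbT -ltnNge.
have := subset_leq_card sub; rewrite card_imset; last exact: pos_inj.
have -> : [set i : 'I_K | (i <= k)%N] = k |: [set x : 'I_K | (x < k)%N].
  by apply/setP => i; rewrite !inE leq_eqVlt -val_eqE.
by rewrite cardsU1 inE ltnn /= add1n ltnn.
Qed.

(** Some item at least as attractive as [k] stands at position [k] or later, and reaching it from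
    [L k] takes upward steps of that total height. *)
Lemma gap_ascent L k : a k - a (L k) <= ascent L.
Proof.
have [y ky yk] := late_item L k.
have := climb L ky; have := alpha_anti ok yk; lra.
Qed.

(** A1 makes the identity optimal, and A5 allows the examination of [L] to be replaced by that of
    the identity. What remains is a sum of attraction gaps weighted by at most [chi_max]. *)
Lemma regret_le_gap L (b : R) : (forall k, a k - a (L k) <= b) -> 0 <= b ->
  opt_rew a c - rew a c L <= K%:R * chi_max c * b.
Proof.
move=> hb b0; apply: (@le_trans _ _ (rew a c 1%g - rew a c L)).
  by rewrite lerD2r opt_rew_le.
have -> : K%:R * chi_max c * b = \sum_(k : 'I_K) chi_max c * b.
  by rewrite sumr_const card_ord -mulrA mulr_natl.
rewrite /rew -sumrB.
apply: ler_sum => k _; rewrite perm1.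
have h1 := cb_A5 ok L k; have h2 := chi_le_max ok 1%g k.
have a0 := alpha_ge0 ok (L k); have c0 := chi_ge0 ok 1%g k.
have h3 : c 1%g k * a (L k) <= c L k * a (L k) by exact: ler_wpM2r.
have h4 : c 1%g k * (a k - a (L k)) <= c 1%g k * b by exact: ler_wpM2l.
have h5 : c 1%g k * b <= chi_max c * b by exact: ler_wpM2r.
lra.
Qed.

Lemma regret_le_ascent L :
  opt_rew a c - rew a c L <= K%:R * chi_max c * Num.min 1 (ascent L).
Proof.
apply: regret_le_gap => [k|]; last by rewrite le_min ler01 ascent_ge0.
rewrite le_min gap_ascent andbT.
by have := alpha_ge0 ok (L k); have := alpha_le1 ok k; lra.
Qed.

Lemma regret_le_K L : opt_rew a c - rew a c L <= K%:R.
Proof.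
apply: le_trans (regret_le_ascent L) _.
rewrite -[leRHS]mulr1 -mulrA ler_wpM2l ?ler0n //.
have m0 : 0 <= Num.min 1 (ascent L) by rewrite le_min ler01 ascent_ge0.
have m1 : Num.min 1 (ascent L) <= 1 by rewrite ge_min lexx.
by rewrite mulr_ile1 // ?(ltW (chi_max_gt0 ok)) // (chi_max_le1 ok).
Qed.

Definition conflict st (x : 'I_K) : R :=
  (unres delta st (st_base st x) (st_base st (nxt x)))%:R
   * `|a (st_base st x) - a (st_base st (nxt x))|.

Lemma conflict_ge0 st x : 0 <= conflict st x.
Proof. by rewrite mulr_ge0. Qed.

(** Since parities alternate, [comp t.+1 st] is the total for the neighbours that round [t]
    skips. *)
Definition comp t st : R := \sum_(x : 'I_K | odd x == odd t) conflict st x.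

Lemma comp_ge0 t st : 0 <= comp t st.
Proof. by apply: sumr_ge0 => x _; exact: conflict_ge0. Qed.

Lemma display_first st t coins (x : 'I_K) : odd x == odd t ->
  `|a (display delta st t coins x) - a (st_base st x)| <= conflict st x.
Proof.
move=> o; case: (ltnP x.+1 K) => xK.
  have [-> _] := display_pair delta st coins (y := Ordinal xK) erefl o.
  rewrite /conflict (@nxt_eq x (Ordinal xK)) //; case: ifP => [/andP[-> _]|_].
    by rewrite mul1r distrC.
  by rewrite subrr normr0 mulr_ge0.
rewrite display_single ?subrr ?normr0 ?conflict_ge0 //.
  by move=> _; apply/eqP; rewrite eqn_leq ltn_ord xK.
by case: (x : nat) o => //= m /eqP <- _; case: (odd m).
Qed.

Lemma display_second st t coins (x : 'I_K) : odd x != odd t ->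
  `|a (display delta st t coins x) - a (st_base st x)|
    <= (0 < x)%N%:R * conflict st (prv x).
Proof.
move=> o; case: (posnP x) => x0.
  rewrite mul0r display_single ?subrr ?normr0 //; last by rewrite x0.
  by rewrite (negbTE o).
have e : x = (prv x).+1 :> nat by rewrite prvE prednK.
have o' : odd (prv x) == odd t.
  by move: o; rewrite {1}e /=; case: (odd _); case: (odd t).
have [_ ->] := display_pair delta st coins e o'.
rewrite /conflict (nxt_eq e) mul1r; case: ifP => [/andP[-> _]|_].
  by rewrite mul1r.
by rewrite subrr normr0 mulr_ge0.
Qed.

(** A step inside a compared pair rises by at most its conflict. A step between two such pairs rises
    by at most its own conflict plus the displacements of its two ends, each bounded by the conflict
    of the adjacent compared pair. A compared pair is thus charged three times: by itself and by the
    steps on either side. *)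
Lemma ascent_display st t coins : correct delta st ->
  ascent (display delta st t coins) <= 3 * comp t st + comp t.+1 st.
Proof.
move=> cor; set L := display _ _ _ _; pose B := st_base st.
(* A pair resolved in its base order is correctly ordered and gives no ascent. *)
have a_base x : a (B (nxt x)) - a (B x) <= conflict st x.
  rewrite /conflict -/B; case: (boolP (unres _ _ _ _)) => [_|/cor/ltnW/(alpha_anti ok)].
    by rewrite mul1r distrC ler_norm.
  by rewrite mul0r; lra.
have h1 (x : 'I_K) : odd x == odd t -> up L x <= conflict st x.
  move=> o; rewrite /up ge_max conflict_ge0 /=; case: (ltnP x.+1 K) => xK; last first.
    by rewrite nxt_last // subrr conflict_ge0.
  have [-> ->] := display_pair delta st coins (y := nxt x) (etrans (nxtE x) (ifT _ _ xK)) o.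
  case: ifP => [/andP[un _]|_]; last exact: a_base.
  by rewrite /conflict un mul1r ler_norm.
have h2 (x : 'I_K) : odd x != odd t -> up L x <= conflict st x
    + ((0 < x)%N%:R * conflict st (prv x) + (x.+1 < K)%N%:R * conflict st (nxt x)).
  move=> o.
  have p0 : 0 <= (0 < x)%N%:R * conflict st (prv x) by rewrite mulr_ge0 ?conflict_ge0.
  have n0 : 0 <= (x.+1 < K)%N%:R * conflict st (nxt x) by rewrite mulr_ge0 ?conflict_ge0.
  have x0 := conflict_ge0 st x.
  rewrite /up ge_max; apply/andP; split; first by lra.
  case: (ltnP x.+1 K) n0 => xK n0; last by rewrite nxt_last // subrr mul0r; lra.
  have on : odd (nxt x) == odd t.
    by rewrite nxtE xK /=; move: o; case: (odd x); case: (odd t).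
  have := display_first st coins on; have := display_second st coins o.
  rewrite -/L -/B !ler_norml => /andP[d1 d2] /andP[d3 d4].
  by have := a_base x; rewrite mul1r; lra.
rewrite /ascent (bigID (fun x : 'I_K => odd x == odd t)) /=.
have s1 : \sum_(x : 'I_K | odd x == odd t) up L x <= comp t st by exact: ler_sum.
have s2 : \sum_(x : 'I_K | odd x != odd t) up L x <= comp t.+1 st +
   (\sum_(x : 'I_K | odd x != odd t) (0 < x)%N%:R * conflict st (prv x)
   + \sum_(x : 'I_K | odd x != odd t) (x.+1 < K)%N%:R * conflict st (nxt x)).
  have -> : comp t.+1 st = \sum_(x : 'I_K | odd x != odd t) conflict st x.
    by apply: eq_bigl => x /=; case: (odd x); case: (odd t).
  by rewrite -!big_split; exact: ler_sum.
have s3 : \sum_(x : 'I_K | odd x != odd t) (0 < x)%N%:R * conflict st (prv x) <= comp t st.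
  rewrite (eq_bigr (fun x : 'I_K => if (0 < x)%N then conflict st (prv x) else 0)).
    rewrite -big_mkcondr; apply: (@ler_sum_image _ _ _ _ _ prv (conflict st)).
    - move=> x y; rewrite !unfold_in => /andP[_ x0] /andP[_ y0] /(congr1 val) /=.
      by rewrite !prvE => e; apply: val_inj => /=; lia.
    - move=> x /andP[o x0]; rewrite prvE.
      by case: (x : nat) o x0 => //= m; case: (odd m); case: (odd t).
    - by move=> z _; exact: conflict_ge0.
  by move=> x _; case: ifP; rewrite ?mul1r ?mul0r.
have s4 : \sum_(x : 'I_K | odd x != odd t) (x.+1 < K)%N%:R * conflict st (nxt x) <= comp t st.
  rewrite (eq_bigr (fun x : 'I_K => if (x.+1 < K)%N then conflict st (nxt x) else 0)).
    rewrite -big_mkcondr; apply: (@ler_sum_image _ _ _ _ _ nxt (conflict st)).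
    - move=> x y; rewrite !unfold_in => /andP[_ x0] /andP[_ y0] /(congr1 val) /=.
      by rewrite !nxtE x0 y0 => -[e]; apply: val_inj.
    - move=> x /andP[o x0]; rewrite nxtE x0.
      by move: o => /=; case: (odd x); case: (odd t).
    - by move=> z _; exact: conflict_ge0.
  by move=> x _; case: ifP; rewrite ?mul1r ?mul0r.
lra.
Qed.

End StepRegret.

(** * The potential and its decrease *)

Section Potential.
Variables (R : realType) (K : nat) (Pa : attr_vec K -> R) (Pc : exam_mat K -> R).
Variables (delta : R) (c0 : nat).
Hypothesis ok : click_bandit Pa Pc.
Hypothesis d01 : 0 < delta < 1.
Implicit Types (st : bstate K) (t : nat) (i j u v : 'I_K).
Implicit Types (w : coin_vec K * attr_vec K * exam_mat K).

Notation a := (alpha Pa).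
Notation c := (chi Pc).
Notation D := (Delta_min a).
Notation LD := (ln delta^-1).
Notation mu := (mu Pa Pc).
Notation outcome := (coin_vec K * attr_vec K * exam_mat K)%type.
Notation stp st t w := (step delta st t w.1.1 w.1.2 w.2).
Notation good := (good Pa delta).
Notation comp := (comp Pa delta).
Notation conflict := (conflict Pa delta).
Notation f := (capf c0 (1 - D)).

Hypothesis c0_ge : 16 * LD / D <= c0%:R.

Definition cap : R := c0%:R + D^-1.

Lemma cap_ge0 : 0 <= cap.
Proof. by rewrite addr_ge0 // invr_ge0 ltW // (Delta_gt0 ok). Qed.

(** With [q = sqrt n] and [l = sqrt L], being unresolved gives [s <= 2 * q * l]. The lower band then
    forces [D * q <= 8 * l], whence [s <= 16 * L / D]. *)
Lemma unres_le_cap st i j : good st -> (i < j)%N -> unres delta st i j ->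
  st_s st i j <= c0%:Z.
Proof.
move=> /goodP g ij; rewrite /unres /ltest => un; have := g _ _ ij.
set n := st_n st i j in un *; set s := st_s st i j in un *.
have L0 := LD_gt0 d01; have D0 := Delta_gt0 ok.
pose q : R := Num.sqrt n%:R; pose l : R := Num.sqrt LD.
have q0 : 0 <= q by exact: sqrtr_ge0.
have l0 : 0 < l by rewrite sqrtr_gt0.
have qq : n%:R = q * q by rewrite -expr2 sqr_sqrtr // ler0n.
have ll : LD = l * l by rewrite -expr2 sqr_sqrtr // ltW.
have eql : Num.sqrt (n%:R * LD) = q * l by rewrite sqrtrM // ler0n.
rewrite eql in un *; rewrite qq => lo.
have h1 : q * (D * q) <= q * (8 * l) by lra.
have h2 : D * q <= 8 * l.
  move: q0; rewrite le_eqVlt => /orP[/eqP <-|q1]; first by rewrite mulr0 mulr_ge0 // ltW.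
  by rewrite -(ler_pM2l q1).
rewrite -(ler_int R) /=; apply: le_trans un _; apply: le_trans c0_ge.
rewrite ler_pdivlMr // ll.
have : l * (D * q) <= l * (8 * l) by rewrite ler_wpM2l // ltW.
lra.
Qed.

Definition score st : R := \sum_(ij : 'I_K * 'I_K | (ij.1 < ij.2)%N) f (st_s st ij.1 ij.2).

Definition gain t st (ij : 'I_K * 'I_K) : R :=
  (linked t (pos (st_base st) ij.1) (pos (st_base st) ij.2)
     && unres delta st ij.1 ij.2)%:R * (chi_min c * (a ij.1 - a ij.2)).

(** An unresolved score lies at or below the cap, where the truncation is linear and the full click
    drift is kept. A resolved score may lie above it, where the drift is only non-negative. *)
Lemma Ex_capf st t i j : wf st -> good st -> (i < j)%N ->
  f (st_s st i j) + gain t st (i, j) <= Ex mu (fun w => f (st_s (stp st t w) i j)).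
Proof.
move=> wst gst ij; have cor := good_correct ok d01 wst gst.
pose lk := linked t (pos (st_base st) i) (pos (st_base st) j).
pose k u (w : outcome) := click delta st t w.1.1 w.1.2 w.2 u.
pose h (b b' : bool) := f (st_s st i j + ((b%:R : int) - b'%:R) *+ lk).
rewrite (_ : Ex mu _ = Ex mu (fun w => h (k i w) (k j w))); last first.
  by apply: eq_Ex => w; have [-> _] := step_stats delta st t w.1.1 w.1.2 w.2 i j.
rewrite /gain /= -/lk.
have [lkT|/negbTE lkF] := boolP lk; last first.
  rewrite mul0r addr0 (@eq_Ex _ _ _ _ (fun=> f (st_s st i j))).
    by rewrite (Ex_cst (mu_pmf ok)).
  by move=> w; rewrite /h lkF mulr0n addr0.
have dr : only mu (k j) (k i) <= (1 - D) * only mu (k i) (k j).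
  by have [] := click_drift ok cor ij lkT.
have dr2 : chi_min c * (a i - a j) <= only mu (k i) (k j) - only mu (k j) (k i).
  by have [] := click_drift ok cor ij lkT.
rewrite (Ex_clicks (mu_pmf ok)); last by rewrite /h lkT.
have -> : h false false = f (st_s st i j) by rewrite /h lkT subrr mul0rn addr0.
have -> : h true false = f (st_s st i j + 1) by rewrite /h lkT subr0 mulr1n.
have -> : h false true = f (st_s st i j - 1) by rewrite /h lkT sub0r mulr1n.
rewrite lerD2l /=; case: (boolP (unres _ _ _ _)) => un.
  by rewrite mul1r capf_drift_lin //; exact: unres_le_cap.
rewrite mul0r; apply: capf_drift_ge0 => //.
- exact: ltW (Delta_gt0 ok).
- exact: Delta_le1.
- exact: only_ge0 (mu_pmf ok) _ _.
Qed.

(* A single bubble pass may leave resolved neighbours out of order; such a state is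
   pending, and its next pass removes an inversion unless the pair falls back to
   unresolved. *)
Definition pending st : bool :=
  [exists x : 'I_K, ~~ unres delta st (st_base st (nxt x)) (st_base st x)].

Definition comp_active t st : R := if pending st then 0 else comp t st.

(** [gain] tests a pair with the better item first, [conflict] in the order of the base list. For
    neighbours in the wrong order, the absence of pending pairs supplies the test that [gain]
    requires. *)
Lemma sum_gain st t : correct delta st ->
  chi_min c * comp_active t st <= \sum_(ij : 'I_K * 'I_K | (ij.1 < ij.2)%N) gain t st ij.
Proof.
move=> cor; pose B := st_base st; have cm := ltW (cb_min ok).
have g0 (ij : 'I_K * 'I_K) : (ij.1 < ij.2)%N -> 0 <= gain t st ij.
  move=> h; rewrite mulr_ge0 // mulr_ge0 // subr_ge0 ltW //; exact: (cb_dec ok).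
rewrite /comp_active; case: ifP => [_|/negbT].
  by rewrite mulr0 sumr_ge0.
rewrite negb_exists => /forallP np; pose o (x : 'I_K) := ordered (B x) (B (nxt x)).
pose P (x : 'I_K) := (odd x == odd t) && (x.+1 < K)%N.
have oE x : P x -> (B x < B (nxt x))%N && (o x == (B x, B (nxt x)))
    || (B (nxt x) < B x)%N && (o x == (B (nxt x), B x)).
  case/andP=> _ xK; rewrite /o; case: (ltngtP (B x) (B (nxt x))) => h.
  - by have [-> _] := ordered_lt h; rewrite eqxx.
  - by have [_ ->] := ordered_lt h; rewrite eqxx.
  - have /(congr1 val) /= := perm_inj (val_inj h); rewrite nxtE xK; lia.
apply: (@le_trans _ _ (\sum_(x | P x) gain t st (o x))); last first.
  apply: (@ler_sum_image _ _ _ P (fun ij : 'I_K * 'I_K => (ij.1 < ij.2)%N) o (gain t st)) => //.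
    move=> x y; rewrite !unfold_in => Px Py e.
    move: (oE x Px) (oE y Py); rewrite e.
    case/andP: Px => _ xK; case/andP: Py => _ yK.
    case/orP=> /andP[_ /eqP ->]; case/orP=> /andP[_ /eqP[]] /perm_inj e1 /perm_inj e2 //.
    + have := congr1 val e1; have := congr1 val e2; rewrite /= !nxtE xK yK; lia.
    + have := congr1 val e1; have := congr1 val e2; rewrite /= !nxtE xK yK; lia.
  by move=> x /oE /orP[]/andP[h /eqP ->].
rewrite /comp mulr_sumr [leLHS](bigID (fun x : 'I_K => (x.+1 < K)%N)) /=.
rewrite [X in _ + X]big1 ?addr0; last first.
  move=> x /andP[_]; rewrite -leqNgt => xK.
  by rewrite /conflict nxt_last // subrr normr0 !mulr0.
apply: ler_sum => x Px; have := oE x Px; have /andP[ox xK] := Px.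
have lk : linked t x (nxt x) by rewrite /linked nxtE xK eqxx ox.
have := np x; rewrite negbK => un'.
case/orP=> /andP[lt /eqP ->]; rewrite /gain /conflict /= !pos_perm -/B.
  rewrite lk /=; case: (unres _ _ _ _); rewrite ?mul0r ?mulr0 // !mul1r ler_wpM2l //.
  by rewrite ger0_norm // subr_ge0 ltW // (cb_dec ok).
rewrite linkedC lk un' /=; rewrite mul1r ler_wpM2l // distrC.
rewrite ger0_norm; last by rewrite subr_ge0 ltW // (cb_dec ok).
rewrite ler_piMl ?lern1 ?leq_b1 // subr_ge0 ltW //; exact: (cb_dec ok).
Qed.

Lemma Ex_score st t : wf st -> good st ->
  score st + chi_min c * comp_active t st <= Ex mu (fun w => score (stp st t w)).
Proof.
move=> wst gst; have cor := good_correct ok d01 wst gst.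
apply: (@le_trans _ _ (score st + \sum_(ij : 'I_K * 'I_K | (ij.1 < ij.2)%N) gain t st ij)).
  by rewrite lerD2l sum_gain.
rewrite Ex_sum -big_split; apply: ler_sum => -[i j] /= ij; exact: Ex_capf.
Qed.

Lemma step_n0 st t w i j : (i < j)%N ->
  (i, j) \notin seen (st_n st) (st_base st) -> st_n (stp st t w) i j = 0%N.
Proof.
move=> ij; have [_ ->] := step_stats delta st t w.1.1 w.1.2 w.2 i j.
rewrite inE /= ij /= negb_or negbK => /andP[/eqP n0 na].
rewrite n0 (_ : linked _ _ _ = false) ?muln0 //.
by apply: contraNF na => /linked_adj.
Qed.

(** Pairs never compared have score 0 and contribute nothing. *)
Lemma score_le st (S : {set 'I_K * 'I_K}) : wf st ->
  (forall i j, (i < j)%N -> (i, j) \notin S -> st_n st i j = 0%N) ->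
  score st <= cap * #|S|%:R.
Proof.
move=> wst n0; rewrite mulr_natr -sumr_const /score.
rewrite [leLHS](bigID [pred ij | ij \in S]) /=.
rewrite [X in _ + X]big1 ?addr0; last first.
  by move=> [i j] /= /andP[ij h]; rewrite (wf_s0 wst) ?capf0 ?n0.
rewrite [leRHS](bigID (fun ij : 'I_K * 'I_K => (ij.1 < ij.2)%N)) /=.
rewrite -[leLHS]addr0; apply: lerD; last by rewrite sumr_ge0 // => ij _; exact: cap_ge0.
rewrite (eq_bigl (fun ij => (ij \in S) && (ij.1 < ij.2)%N)); last first.
  by move=> ij; rewrite andbC.
apply: ler_sum => ij _; apply: capf_le; [exact: Delta_gt0 ok|exact: Delta_le1].
Qed.

(** Bounds the number of pairs ever compared as long as states stay good: every inversion still to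
    be removed may create two new neighbouring pairs. *)
Definition budget st : nat := (#|seen (st_n st) (st_base st)| + 2 * #|Vset (st_base st)|)%N.

(* The factor 4 pays for the 3 by which compared pairs weigh in the regret and for
   the term [comp_active], which hands the other pairs over to the next round. *)
Definition pot t st : R :=
  4 / chi_min c * (cap * (budget st)%:R - score st)
  - comp_active t st + K%:R + 2 * #|Vset (st_base st)|%:R + (pending st)%:R.

(** The share of the regret not paid by score growth in this round: the skipped pairs, or the whole
    capped regret if the state is pending. *)
Definition quick t st : R := if pending st then 1 else Num.min 1 (comp t.+1 st).

Lemma quick_le1 t st : quick t st <= 1.
Proof. by rewrite /quick; case: ifP => // _; rewrite ge_min lexx. Qed.

Lemma comp_active_ge0 t st : 0 <= comp_active t st.
Proof. by rewrite /comp_active; case: ifP => // _; exact: comp_ge0. Qed.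

Lemma comp_active_le t st : comp_active t st <= K%:R.
Proof.
have h : \sum_(x : 'I_K) (1 : R) = K%:R by rewrite sumr_const card_ord.
rewrite /comp_active; case: ifP => // _; rewrite -h.
rewrite [leRHS](bigID (fun x : 'I_K => odd x == odd t)) /= -[leLHS]addr0.
apply: lerD; last by rewrite sumr_ge0.
apply: ler_sum => x _; rewrite mulr_ile1 ?lern1 ?leq_b1 // ler_norml.
have := alpha_ge0 ok (st_base st x); have := alpha_le1 ok (st_base st x).
have := alpha_ge0 ok (st_base st (nxt x)); have := alpha_le1 ok (st_base st (nxt x)).
by move=> h1 h2 h3 h4; apply/andP; split; lra.
Qed.

Lemma pot_ge0 t st : wf st -> 0 <= pot t st.
Proof.
move=> wst; have h1 := comp_active_le t st.
have : 0 <= 4 / chi_min c * (cap * (budget st)%:R - score st).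
  rewrite mulr_ge0 ?divr_ge0 ?(ltW (cb_min ok)) // subr_ge0.
  apply: le_trans (score_le (S := seen (st_n st) (st_base st)) wst _) _.
    by move=> i j ij; rewrite inE /= ij /= negb_or negbK => /andP[/eqP].
  by rewrite ler_wpM2l ?cap_ge0 // ler_nat leq_addr.
rewrite /pot; set V := #|_|; have : 0 <= V%:R :> R by [].
have : 0 <= (pending st)%:R :> R by [].
lra.
Qed.

(** Pairs of the other parity receive no comparison in round [t], so with an unchanged base list
    their conflicts carry over to the next round. *)
Lemma comp_other st t w : st_base (stp st t w) = st_base st ->
  comp t.+1 (stp st t w) = comp t.+1 st.
Proof.
move=> e; apply: eq_bigr => x ox; rewrite /conflict e /unres.
have [-> ->] := step_stats delta st t w.1.1 w.1.2 w.2
   (st_base st x) (st_base st (nxt x)).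
rewrite !pos_perm (_ : linked _ _ _ = false) ?mulr0n ?muln0 ?addr0 ?addn0 //.
rewrite /linked nxtE; case: ifP => _; last by rewrite !ltn_eqF.
move: ox => /=; rewrite eqxx [x == _ :> nat]ltn_eqF ?orbF /=; last by lia.
by case: (odd x); case: (odd t).
Qed.

Lemma pot_step st t w : wf st -> good st ->
  (good (stp st t w))%:R * pot t.+1 (stp st t w) <=
    4 / chi_min c * (cap * (budget st)%:R - score (stp st t w))
    + K%:R + 2 * #|Vset (st_base st)|%:R + (pending st)%:R - quick t st.
Proof.
move=> wst gst; set st' := stp st t w.
have wst' : wf st' by exact: wf_step.
have cm : 0 <= 4 / chi_min c by rewrite divr_ge0 // ltW // (cb_min ok).
have q1 := quick_le1 t st; have K1 : 1 <= K%:R :> R by rewrite ler1n (K_gt0 ok).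
have p0 : 0 <= (pending st)%:R :> R by [].
have V0 : 0 <= #|Vset (st_base st)|%:R :> R by [].
case: (boolP (good st')) => [gst'|_]; last first.
  rewrite mul0r.
  have : 0 <= 4 / chi_min c * (cap * (budget st)%:R - score st').
    rewrite mulr_ge0 // subr_ge0; apply: le_trans (score_le wst' (@step_n0 st t w)) _.
    by rewrite ler_wpM2l ?cap_ge0 // ler_nat leq_addr.
  lra.
rewrite mul1r /pot.
have cor' := good_correct ok d01 wst' gst'.
have [hb hV] := @upd_baseP R K delta (st_s st') (st_n st') (st_base st) cor'.
rewrite -[upd_base _ _ _ _]/(st_base st') in hb hV.
have sub : seen (st_n st') (st_base st) \subset seen (st_n st) (st_base st).
  by apply: seen_sub => i j; exact: step_n0.
have hC : (budget st' <= budget st)%N.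
  by apply: leq_trans hb _; rewrite leq_add2r subset_leq_card.
have hC' : 4 / chi_min c * (cap * (budget st')%:R - score st') <=
           4 / chi_min c * (cap * (budget st)%:R - score st').
  by rewrite ler_wpM2l // lerD2r ler_wpM2l ?cap_ge0 // ler_nat.
suff : - comp_active t.+1 st' + 2 * #|Vset (st_base st')|%:R + (pending st')%:R
   <= 2 * #|Vset (st_base st)|%:R + (pending st)%:R - quick t st by lra.
(* If the list changes, the lost inversion frees 2: one unit for [quick] and one for a newly pending
   state. If it does not, the new state is not pending, and [quick] is paid by the former pending
   indicator or by [comp_active] of the next round. *)
case: hV => [lt|[eB np]].
  have c0' := comp_active_ge0 t.+1 st'.
  have : (pending st')%:R <= 1 :> R by rewrite lern1 leq_b1.
  have : #|Vset (st_base st')|%:R + 1 <= #|Vset (st_base st)|%:R :> R.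
    by rewrite natr1 ler_nat.
  lra.
have np' : pending st' = false.
  apply/negbTE; rewrite negb_exists; apply/forallP => x; rewrite negbK eB.
  case: (ltnP x.+1 K) => xK; first by apply: np; rewrite nxtE xK.
  rewrite nxt_last //; apply/negPn/negP => /cor'; by rewrite ltnn.
rewrite np' /comp_active np' eB comp_other // /quick.
have := comp_ge0 Pa delta t.+1 st.
case: ifP => _ h; rewrite /=; first by lra.
have : Num.min 1 (comp t.+1 st) <= comp t.+1 st by rewrite ge_min lexx orbT.
lra.
Qed.

Lemma Ex_pot st t : wf st -> good st ->
  Ex mu (fun w => (good (stp st t w))%:R * pot t.+1 (stp st t w))
    <= pot t st - (3 * comp_active t st + quick t st).
Proof.
move=> wst gst; have cm := cb_min ok.
apply: le_trans (Ex_le (mu_pmf ok) (fun w => pot_step t w wst gst)) _.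
set b := 4 / chi_min c.
have -> : Ex mu (fun w : outcome => b * (cap * (budget st)%:R - score (stp st t w)) + K%:R +
     2 * #|Vset (st_base st)|%:R + (pending st)%:R - quick t st) =
  b * (cap * (budget st)%:R - Ex mu (fun w => score (stp st t w))) + (K%:R +
     2 * #|Vset (st_base st)|%:R + (pending st)%:R - quick t st).
  rewrite -[in RHS](Ex_cst (mu_pmf ok) (cap * _)) -ExN -ExD -ExZ.
  rewrite -[X in _ = _ + X](Ex_cst (mu_pmf ok)) -ExD; apply: eq_Ex => w.
  by rewrite !addrA.
have h := Ex_score t wst gst; rewrite /pot -/b.
have : b * (score st + chi_min c * comp_active t st) <=
       b * Ex mu (fun w => score (stp st t w)).
  by rewrite ler_wpM2l // divr_ge0 // ltW.
have -> : b * (score st + chi_min c * comp_active t st) =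
    b * score st + 4 * comp_active t st.
  by rewrite /b; field; exact: lt0r_neq0.
lra.
Qed.

Lemma regret_step_le st t coins : wf st -> good st ->
  opt_rew a c - rew a c (display delta st t coins) <=
    K%:R * chi_max c * (3 * comp_active t st + quick t st).
Proof.
move=> wst gst; apply: le_trans (regret_le_ascent ok _) _.
rewrite ler_wpM2l ?mulr_ge0 ?(ltW (chi_max_gt0 ok)) //.
have := ascent_display ok t coins (good_correct ok d01 wst gst).
set A := ascent _ _; rewrite /comp_active /quick.
case: ifP => _ h; first by rewrite mulr0 add0r ge_min lexx.
have h0 := comp_ge0 Pa delta t st.
rewrite minEle; case: ifP => h1; rewrite minEle; case: ifP => h2; lra.
Qed.

End Potential.

(** * Induction on the remaining rounds and the final constants *)

Section RegretBound.
Variables (R : realType) (K : nat) (Pa : attr_vec K -> R) (Pc : exam_mat K -> R).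
Variable delta : R.
Hypothesis ok : click_bandit Pa Pc.
Hypothesis d01 : 0 < delta < 1.
Implicit Types (st : bstate K) (t m N : nat).

Notation a := (alpha Pa).
Notation c := (chi Pc).
Notation D := (Delta_min a).
Notation LD := (ln delta^-1).
Notation stp st t w := (step delta st t w.1.1 w.1.2 w.2).

Lemma regret_fromS m t st : regret_from Pa Pc delta m.+1 t st =
  Ex (mu Pa Pc) (fun w => (opt_rew a c - rew a c (display delta st t w.1.1))
    + regret_from Pa Pc delta m t.+1 (stp st t w)).
Proof.
exact: (Ex_mu _ _ (fun x A X => (opt_rew a c - rew a c (display delta st t x))
    + regret_from Pa Pc delta m t.+1 (step delta st t x A X))).
Qed.

Lemma regret_from_cst (b : R) m t st :
  (forall L, opt_rew a c - rew a c L <= b) -> regret_from Pa Pc delta m t st <= m%:R * b.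
Proof.
move=> hb; elim: m t st => [|m IH] t st; first by rewrite mul0r.
rewrite regret_fromS -[leRHS](Ex_cst (mu_pmf ok)); apply: (Ex_le (mu_pmf ok)) => w.
have := hb (display delta st t w.1.1); have := IH t.+1 (stp st t w).
by rewrite -[in X in _ -> _ -> _ <= X]natr1; lra.
Qed.

(** In a good state the potential drop pays for the round and [failure] does not increase in
    expectation. In a bad state [failure] is at least 1, so its term covers the trivial bound [K]
    per remaining round. The condition with [N] keeps all counts within the range summed in
    [failure]. *)
Lemma regret_from_le (c0 : nat) N m t st : 16 * LD / D <= c0%:R -> wf st ->
  (forall u v, st_n st u v + m <= N)%N ->
  regret_from Pa Pc delta m t st <=
    K%:R * chi_max c * ((good Pa delta st)%:R * pot Pa Pc delta c0 t st)
    + K%:R * m%:R * failure Pa delta N st.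
Proof.
move=> hc0; have X0 := ltW (chi_max_gt0 ok).
have KX : 0 <= K%:R * chi_max c by rewrite mulr_ge0.
elim: m t st => [|m IH] t st wst nN.
  by rewrite mulr0 mul0r addr0 !mulr_ge0 // (pot_ge0 delta c0 ok).
case: (boolP (good Pa delta st)) => gst; last first.
  rewrite mul0r mulr0 add0r.
  apply: le_trans (regret_from_cst _ _ _ (regret_le_K ok)) _.
  rewrite [K%:R * _]mulrC ler_peMr ?mulr_ge0 //.
  by apply: (failure_bad ok) => // u v; apply: leq_trans (nN u v); exact: leq_addr.
rewrite regret_fromS mul1r.
pose G w := K%:R * chi_max c * (3 * comp_active Pa delta t st + quick Pa delta t st)
  + (K%:R * chi_max c * ((good Pa delta (stp st t w))%:R * pot Pa Pc delta c0 t.+1 (stp st t w))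
     + K%:R * m%:R * failure Pa delta N (stp st t w)).
apply: (@le_trans _ _ (Ex (mu Pa Pc) G)).
  apply: (Ex_le (mu_pmf ok)) => w; apply: lerD; first exact: regret_step_le.
  apply: IH; first exact: wf_step.
  move=> u v; apply: leq_trans (nN u v); rewrite -addSnnS leq_add2r.
  exact: step_n_le.
rewrite /G !ExD (Ex_cst (mu_pmf ok)) [Ex _ (fun w => K%:R * m%:R * _)]ExZ (ExZ _ (K%:R * chi_max c)).
have h1 := Ex_pot ok d01 hc0 t wst gst.
have h2 := Ex_failure ok d01 N t wst gst.
have h3 := failure_ge0 Pa delta N st.
have h4 : K%:R * m%:R * failure Pa delta N st <= K%:R * m.+1%:R * failure Pa delta N st.
  by rewrite ler_wpM2r // ler_wpM2l // ler_nat.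
have h5 := ler_wpM2l KX h1.
have Km : 0 <= K%:R * m%:R :> R by rewrite mulr_ge0.
have h6 := ler_wpM2l Km h2.
apply: le_trans (lerD (lexx _) (lerD h5 h6)) _; lra.
Qed.

Lemma good_init R0 : good Pa delta (init_state R0).
Proof. by apply/goodP => i j _ /=; rewrite mulr0 mul0r sqrtr0 mulr0 subrr. Qed.

Lemma LD_ge : 1 - delta <= LD.
Proof.
have /andP[d0 _] := d01; have := expR_ge1Dx (- LD).
by rewrite lnV // opprK lnK //; lra.
Qed.

Lemma pot_init (c0 : nat) R0 : (1 < K)%N -> 15 / 16 <= LD ->
  c0%:R <= 16 * LD / D + 1 ->
  pot Pa Pc delta c0 1 (init_state R0) <=
    180 * ((K%:R - 1 + 2 * #|Vset R0|%:R) / D) * LD / chi_min c.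
Proof.
move=> K2 L1 hc0; set V := #|_|.
have D0 := Delta_gt0 ok; have D1 := Delta_le1 Pa; have X0 := cb_min ok.
have X1 : chi_min c <= 1 := le_trans (chi_min_le ok 1%g (Ordinal (K_gt0 ok))) (chi_le1 ok _ _).
pose C : R := K%:R - 1 + 2 * V%:R.
have KR : 2 <= K%:R :> R by rewrite ler_nat.
have V0 : 0 <= V%:R :> R by [].
have C1 : 1 <= C by rewrite /C; lra.
have C0 : 0 <= C by lra.
have hb : (budget (init_state R0))%:R <= C.
  have : (budget (init_state R0) <= K.-1 + 2 * V)%N.
    by rewrite leq_add2r; exact: card_seen_init R0 (K_gt0 ok).
  rewrite -(ler_nat R) natrD natrM => /le_trans; apply.
  by rewrite /C -subn1 natrB // (K_gt0 ok).
have sc : score Pa c0 (init_state R0) = 0 by rewrite /score big1 // => ij _; exact: capf0.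
have cp : cap Pa c0 * D <= 16 * LD + 2.
  rewrite /cap mulrDl mulVf ?lt0r_neq0 //.
  have : c0%:R * D <= (16 * LD / D + 1) * D by rewrite ler_pM2r.
  rewrite mulrDl mulfVK ?lt0r_neq0 //; lra.
have ca := comp_active_ge0 Pa delta 1 (init_state R0).
have pe : (pending delta (init_state R0))%:R <= 1 :> R by rewrite lern1 leq_b1.
have cg : 0 <= cap Pa c0 := cap_ge0 c0 ok.
rewrite /pot sc subr0 -[st_base _]/R0 -/V -/C.
have h1 : cap Pa c0 * (budget (init_state R0))%:R <= cap Pa c0 * C by rewrite ler_wpM2l.
have h2 : 4 / chi_min c * (cap Pa c0 * (budget (init_state R0))%:R)
   <= 4 / chi_min c * (cap Pa c0 * C).
  by rewrite ler_wpM2l // divr_ge0 // ltW.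
(* The remaining terms of the potential are at most [K + 2 * V + 1 = C + 2], which is at most
   [3 * C] because [C >= 1]. *)
apply: (@le_trans _ _ (4 / chi_min c * (cap Pa c0 * C) + 3 * C)).
  by rewrite /C in h2 *; lra.
have -> : 4 / chi_min c * (cap Pa c0 * C) + 3 * C =
   (4 * (cap Pa c0 * D) * C + 3 * (D * chi_min c) * C) / (D * chi_min c).
  by field; rewrite !lt0r_neq0.
have -> : 180 * (C / D) * LD / chi_min c = (180 * LD * C) / (D * chi_min c).
  by field; rewrite !lt0r_neq0.
rewrite ler_wpM2r ?invr_ge0 ?mulr_ge0 ?(ltW D0) ?(ltW X0) // -mulrDl ler_wpM2r //.
(* The bound left is [4 * (16 * L + 2) + 3 <= 180 * L], which [L >= 15 / 16] ensures. *)
have : D * chi_min c <= 1 by rewrite mulr_ile1 // ltW.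
lra.
Qed.

End RegretBound.

Theorem theorem1 (R : realType) (K : nat)
  (Pa : attr_vec K -> R) (Pc : exam_mat K -> R)
  (delta : R) (n : nat) (R0 : {perm 'I_K}) :
  is_pmf Pa -> is_pmf Pc ->
  A1 (alpha Pa) (chi Pc) -> A2 (chi Pc) -> A3 (chi Pc) ->
  A4 (alpha Pa) (chi Pc) -> A5 (chi Pc) ->
  (forall i j : 'I_K, (i < j)%N -> alpha Pa j < alpha Pa i) ->
  (forall i : 'I_K, 0 < alpha Pa i) ->
  0 < chi_min (chi Pc) ->
  0 < delta < 1 ->
  bubblerank_regret Pa Pc delta R0 n <=
    180 * K%:R * (chi_max (chi Pc) / chi_min (chi Pc))
      * ((K%:R - 1 + 2 * #|Vset R0|%:R) / Delta_min (alpha Pa))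
      * ln (delta^-1)
    + Num.sqrt delta * K%:R ^+ 3 * n%:R ^+ 2.
Proof.
move=> pA pC h1 h2 h3 h4 h5 adec _ cm d01.
have ok : click_bandit Pa Pc by [].
have L0 := LD_gt0 d01; have D0 := Delta_gt0 ok; have X0 := chi_max_gt0 ok.
have K1 := K_gt0 ok; have KR : 1 <= K%:R :> R by rewrite ler1n.
have sd := sqrtr_ge0 delta.
have T1 : 0 <= 180 * K%:R * (chi_max (chi Pc) / chi_min (chi Pc))
      * ((K%:R - 1 + 2 * #|Vset R0|%:R) / Delta_min (alpha Pa)) * ln (delta^-1).
  rewrite !mulr_ge0 ?invr_ge0 ?(ltW X0) ?(ltW cm) ?(ltW D0) ?(ltW L0) //.
  by rewrite addr_ge0 ?mulr_ge0 // subr_ge0.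
have T2 : 0 <= Num.sqrt delta * K%:R ^+ 3 * n%:R ^+ 2.
  by rewrite !mulr_ge0 // exprn_ge0.
rewrite /bubblerank_regret.
(* For [K = 1] there is only one list, so no round has regret. *)
case: (ltnP 1 K) => K2; last first.
  have r0 L : opt_rew (alpha Pa) (chi Pc) - rew (alpha Pa) (chi Pc) L <= 0.
    rewrite -[leRHS](mulr0 (K%:R * chi_max (chi Pc))).
    apply: (regret_le_gap ok) => // k.
    suff -> : L k = k by rewrite subrr.
    by apply: val_inj => /=; have := ltn_ord k; have := ltn_ord (L k); lia.
  apply: le_trans (regret_from_cst delta ok n 1 (init_state R0) r0) _.
  by rewrite mulr0 addr_ge0.
have KR2 : 2 <= K%:R :> R by rewrite ler_nat.
(* For [sqrt delta >= 1 / 4] the trivial bound [n * K] is already below the second term, as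
   [K ^+ 2 >= 4]. Otherwise [delta <= 1 / 16] and [L >= 1 - delta >= 15 / 16]. *)
case: (lerP 4^-1 (Num.sqrt delta)) => hd.
  apply: le_trans (regret_from_cst delta ok n 1 (init_state R0) (regret_le_K ok)) _.
  apply: (@le_trans _ _ (Num.sqrt delta * K%:R ^+ 3 * n%:R ^+ 2)); last by rewrite lerDr.
  have nn : n%:R <= n%:R ^+ 2 :> R by rewrite -natrX ler_nat; case: (n) => // m; rewrite leq_pmulr.
  have k4 : 4 * K%:R <= K%:R ^+ 3 :> R.
    rewrite exprSr ler_wpM2r // (_ : 4 = 2 ^+ 2); last by ring.
    by rewrite ler_pXn2r // nnegrE.
  have : 4^-1 * (4 * K%:R) <= Num.sqrt delta * K%:R ^+ 3.
    by apply: ler_pM; rewrite ?invr_ge0 ?mulr_ge0 ?ler0n.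
  rewrite (_ : 4^-1 * (4 * K%:R) = K%:R); last by field.
  move=> k5.
  by rewrite mulrC; apply: ler_pM.
have d16 : delta <= 16^-1.
  rewrite -(sqr_sqrtr (ltW (andP d01).1)) (_ : 16^-1 = (4^-1) ^+ 2); last by field.
  by rewrite ler_pXn2r ?nnegrE ?invr_ge0 ?ler0n ?sqrtr_ge0 //; exact: ltW.
have L1 : 15 / 16 <= ln delta^-1 by have := LD_ge d01; lra.
(* The cap must be a natural number; the successor of the integer part of [x] exceeds [16 * L / D]
   by at most 1. *)
pose x := 16 * ln delta^-1 / Delta_min (alpha Pa).
have x0 : 0 <= x by rewrite divr_ge0 ?mulr_ge0 // ltW.
have /andP[x1 x2] := truncn_itv x0.
have hc : x <= (Num.truncn x).+1%:R by exact: ltW.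
have hc' : (Num.truncn x).+1%:R <= x + 1 by rewrite -natr1 lerD2r.
have main := regret_from_le ok d01 1 hc (wf_init R0) (N := n) (m := n) (fun u v => leqnn n).
apply: le_trans main _; rewrite (good_init Pa delta R0) mul1r.
apply: lerD.
  have pi := pot_init ok R0 K2 L1 hc'.
  have KX : 0 <= K%:R * chi_max (chi Pc) by rewrite mulr_ge0 // ltW.
  apply: le_trans (ler_wpM2l KX pi) _.
  by rewrite le_eqVlt; apply/orP; left; apply/eqP; field; rewrite !lt0r_neq0.
apply: le_trans (ler_wpM2l _ (failure_init Pa delta n R0)) _; first by rewrite mulr_ge0.
by rewrite le_eqVlt; apply/orP; left; apply/eqP; ring.
Qed.
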